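(* Let $(G,X,x_0)$ be a $0$-dimensional ambit, $\mathcal{B}$ the Boolean algebra of clopen subsets of $X$, $\mathcal{M}$ a minimal left ideal in $E(X)$ and $u$ an idempotent in $\mathcal{M}$. Consider the following conditions. ($A'''$) The Bohr compactification of $G$ below $(G,X,x_0)$ is profinite. ($A''$) The Bohr compactification of $G$ below $(G,E(X),\mathrm{id})$ is profinite. ($A'$) $u\mathcal{M}/H(u\mathcal{M})$ is profinite. ($A$) $u\mathcal{M}$ is profinite. ($B$) $X\cong\varprojlim X_i$ as $G$-flows, where the Ellis groups of all the flows $X_i$ are finite. ($C$) For every finite $\Delta\subseteq G\backslash\mathcal{B}$ the Ellis group of $S_\Delta(X)$ is finite. ($D$) For every finite $\Delta\subseteq G\backslash\mathcal{B}$ there exists $\eta\in E(S_\Delta(X))$ with finite image. Then $(D)\Rightarrow(C)\Leftrightarrow(B)\Rightarrow(A)\Rightarrow(A')\Rightarrow(A'')\Rightarrow(A''')$.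
   Context: Compact spaces are Hausdorff. A flow $(G,X)$ is a topological group $G$ acting continuously on a compact space $X$. An ambit $(G,X,x_0)$ is a flow with a distinguished point $x_0\in X$ whose orbit is dense; it is $0$-dimensional if $X$ has a basis of clopen sets. The Ellis semigroup $E(X)$ of a flow is the closure in $X^X$ (product topology) of the set of maps $x\mapsto gx$, $g\in G$, with composition; it is a $G$-ambit with distinguished point $\mathrm{id}=\mathrm{id}_X$. For a minimal left ideal $\mathcal{M}$ of $E(X)$ and an idempotent $u\in\mathcal{M}$, $u\mathcal{M}$ is a group; its isomorphism type does not depend on $\mathcal{M},u$ and it is called the Ellis group of $X$. It carries the $\tau$-topology: for $a\in E(X)$, $B\subseteq E(X)$ let $a\circ B$ be the set of all limits of nets $(g_ib_i)_i$ with $g_i\in G$, $b_i\in B$, $\lim_i g_i=a$; the closure operator on $u\mathcal{M}$ is $\mathrm{cl}_\tau(B)=u\mathcal{M}\cap(u\circ B)$ for $B\subseteq u\mathcal{M}$. $H(u\mathcal{M})=\bigcap_U\mathrm{cl}_\tau(U)$, with $U$ ranging over the $\tau$-open neighborhoods of $u$ in $u\mathcal{M}$; it is a $\tau$-closed normal subgroup and $u\mathcal{M}/H(u\mathcal{M})$ (quotient topology) is a compact Hausdorff topological group. ''$u\mathcal{M}$ is profinite'' means that it is a profinite topological group in the $\tau$-topology. For any ambit $(G,Y,y_0)$, a compactification of $G$ below $(G,Y,y_0)$ is a group homomorphism $h\colon G\to K$ with dense image, $K$ a compact group, such that $h=f_1\circ f_2$, where $f_2\colon G\to Y$, $f_2(g)=gy_0$,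 and $f_1\colon Y\to K$ is an epimorphism of ambits (continuous surjective $G$-map with $f_1(y_0)=e_K$), $G$ acting on $K$ by $g\cdot k=h(g)k$. The Bohr compactification of $G$ below $(G,Y,y_0)$ is the universal compactification $\mathfrak{b}\colon G\to K_{\mathfrak b}$ of $G$ below $(G,Y,y_0)$, i.e. every compactification $h\colon G\to K$ of $G$ below $(G,Y,y_0)$ is $\varphi\circ\mathfrak{b}$ for a unique continuous homomorphism $\varphi\colon K_{\mathfrak b}\to K$; it exists and is unique up to isomorphism. The target group $K_{\mathfrak b}$ is also called the Bohr compactification. $G\backslash\mathcal{B}$ is the set of all $G$-orbits $GU=\{gU:g\in G\}$, $U\in\mathcal{B}$. For $\Delta\subseteq G\backslash\mathcal{B}$, $\mathcal{A}(\Delta)$ is the Boolean $G$-algebra (Boolean algebra closed under the $G$-action) of subsets of $X$ generated by $\bigcup\Delta$, and $S_\Delta(X)$ is the Stone space of $\mathcal{A}(\Delta)$ with the natural left $G$-action (a $G$-flow). *)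

(* Defs.v *)
From HB Require Import structures.
From mathcomp Require Import all_boot all_classical topology.

Set Implicit Arguments.
Unset Strict Implicit.
Unset Printing Implicit Defensive.

Local Open Scope classical_set_scope.
Local Open Scope group_scope.

#[short(type="preTopologicalGroupType")]
HB.structure Definition PreTopologicalGroup := {G of Group G & Topological G}.

HB.mixin Record PreTopologicalGroup_isTopologicalGroup G
    & PreTopologicalGroup G := {
  mulg_continuous : continuous (fun xy : G * G => xy.1 * xy.2);
  invg_continuous : continuous (fun x : G => x^-1)
}.

#[short(type="topologicalGroupType")]
HB.structure Definition TopologicalGroup :=
  {G of PreTopologicalGroup G & PreTopologicalGroup_isTopologicalGroup G}.

(* G itself need not be Hausdorff; compact spaces are Hausdorff by convention. *)
HB.mixin Record isFlow (G : topologicalGroupType) X & Topological X := {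
  act : G -> X -> X;
  act1 : forall x, act 1 x = x;
  actM : forall g h x, act (g * h) x = act g (act h x);
  act_continuous : continuous (fun gx : (G * X)%type => act gx.1 gx.2);
  flow_compact : compact [set: X];
  flow_hausdorff : hausdorff_space X
}.

#[short(type="flowType")]
HB.structure Definition Flow (G : topologicalGroupType) :=
  {X of isFlow G X & Topological X}.

Section FlowTheory.
Variables (G : topologicalGroupType) (X : flowType G).

Lemma actK (g : G) (x : X) : act g^-1 (act g x) = x.
Proof. by rewrite -actM mulVg act1. Qed.

Lemma actVK (g : G) (x : X) : act g (act g^-1 x) = x.
Proof. by rewrite -actM mulgV act1. Qed.

Lemma act_cts (g : G) : continuous (act g : X -> X).
Proof.
move=> x; apply: (@continuous_comp _ _ _ (fun y : X => (g, y))
  (fun gx : (G * X)%type => act gx.1 gx.2)); last exact: act_continuous.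
by apply: cvg_pair; [exact: cvg_cst|exact: cvg_id].
Qed.

Lemma act_cts1 (x : X) : continuous (fun g : G => act g x).
Proof.
move=> g; apply: (@continuous_comp _ _ _ (fun h : G => (h, x))
  (fun gx : (G * X)%type => act gx.1 gx.2)); last exact: act_continuous.
by apply: cvg_pair; [exact: cvg_id|exact: cvg_cst].
Qed.

Definition act_orbit (x : X) : set X := [set act g x | g in [set: G]].

Definition ambit (x0 : X) : Prop := dense (act_orbit x0).

Definition invariant (A : set X) : Prop := forall g x, A x -> A (act g x).

Lemma invariant_orbit_closure (x : X) : invariant (closure (act_orbit x)).
Proof.
move=> g y cly B Bgy; have /cly[z [[h _ <-] Bz]] := act_cts Bgy.
by exists (act g (act h x)); split => //; exists (g * h) => //; rewrite actM.
Qed.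

End FlowTheory.

(* The library's zero_dimensional only asks that clopen sets separate points. *)
Definition zero_dimensional_basis (X : topologicalType) : Prop :=
  exists2 B : set (set X), basis B & B `<=` clopen.

Lemma prod_cvgP (I : Type) (X : I -> topologicalType)
    (F : set_system (prod_topology X)) (f : prod_topology X) :
  Filter F ->
  F --> f <-> forall i, (fun x : prod_topology X => x i) @ F --> f i.
Proof.
move=> FF; rewrite cvg_sup; split=> cvF i.
  move=> U /= /nbhs_interior Ui.
  apply: (cvF i ((fun x : prod_topology X => x i) @^-1` U)).
  exists ((fun x : prod_topology X => x i) @^-1` interior U); split.
  - by exists (interior U) => //; exact: open_interior.
  - exact: (nbhs_singleton Ui).
  - by move=> x /=; exact: interior_subset.
move=> U [_ [[W oW <-] Wf WU]]; apply: filterS WU _.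
by apply: (cvF i W); exact: open_nbhs_nbhs.
Qed.

Lemma prod_eval_continuous (I : Type) (X : I -> topologicalType) (i : I) :
  continuous (fun x : prod_topology X => x i).
Proof. by move=> x; apply: ((prod_cvgP x (nbhs_filter x)).1 _ i); exact: cvg_id. Qed.

Section ProductFlow.
Variables (G : topologicalGroupType) (I : Type) (X : I -> flowType G).

Local Notation P := (prod_topology X).

Definition prod_act (g : G) (x : P) : P := fun i => act g (x i).

Lemma prod_act1 x : prod_act 1 x = x.
Proof. by apply: functional_extensionality_dep => i; exact: act1. Qed.

Lemma prod_actM g h x : prod_act (g * h) x = prod_act g (prod_act h x).
Proof. by apply: functional_extensionality_dep => i; exact: actM. Qed.

Lemma prod_act_continuous :
  continuous (fun gx : (G * P)%type => prod_act gx.1 gx.2).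
Proof.
move=> [g x]; apply/prod_cvgP => i.
apply: (@continuous_comp _ _ _ (fun gx : (G * P)%type => (gx.1, gx.2 i))
  (fun gx : (G * X i)%type => act gx.1 gx.2)); last exact: act_continuous.
apply: cvg_pair; first exact: cvg_fst.
apply: (@continuous_comp _ _ _ (@snd G P) (fun y : P => y i)).
  exact: cvg_snd.
exact: prod_eval_continuous.
Qed.

Lemma prod_flow_compact : compact [set: P].
Proof.
have := @tychonoff {classic I} X (fun _ => setT) (fun i => @flow_compact G (X i)).
by congr (compact _); apply/seteqP; split.
Qed.

Lemma prod_flow_hausdorff : hausdorff_space P.
Proof.
exact: (@hausdorff_product {classic I} X (fun i => @flow_hausdorff G (X i))).
Qed.

HB.instance Definition _ := isFlow.Build G (prod_topology X)
  prod_act1 prod_actM prod_act_continuous prod_flow_compact prod_flow_hausdorff.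

End ProductFlow.

Definition subflow (G : topologicalGroupType) (X : flowType G) (A : set X)
  (cA : closed A) (iA : invariant A) : Type := set_type A.

Section Subflow.
Variables (G : topologicalGroupType) (X : flowType G) (A : set X).
Hypotheses (cA : closed A) (iA : invariant A).

Local Notation S := (subflow cA iA).

HB.instance Definition _ := Topological.on S.
HB.instance Definition _ := SubType.on S.

Lemma subflow_subproof (g : G) (x : S) : act g (val x) \in A.
Proof. by apply/mem_set/iA; have := valP x; rewrite inE. Qed.

Definition subflow_act (g : G) (x : S) : S :=
  exist _ (act g (val x)) (subflow_subproof g x).

Lemma val_subflow_act g x : val (subflow_act g x) = act g (val x).
Proof. by []. Qed.

Lemma subflow_act1 x : subflow_act 1 x = x.
Proof. by apply: val_inj; rewrite val_subflow_act act1. Qed.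

Lemma subflow_actM g h x : subflow_act (g * h) x = subflow_act g (subflow_act h x).
Proof. by apply: val_inj; rewrite !val_subflow_act actM. Qed.

Lemma val_subflow_continuous : continuous (val : S -> X).
Proof. exact: (@initial_continuous (set_type A) X set_val). Qed.

Lemma subflow_act_continuous :
  continuous (fun gx : (G * S)%type => subflow_act gx.1 gx.2).
Proof.
apply: (@continuous_comp_initial (set_type A) (G * S)%type X set_val).
move=> [g x]; apply: (@continuous_comp _ _ _
  (fun gx : (G * S)%type => (gx.1, val gx.2))
  (fun gx : (G * X)%type => act gx.1 gx.2)); last exact: act_continuous.
apply: cvg_pair; first exact: cvg_fst.
apply: (@continuous_comp _ _ _ (@snd G S) (val : S -> X)).
  exact: cvg_snd.
exact: val_subflow_continuous.
Qed.

Lemma subflow_hausdorff : hausdorff_space S.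
Proof.
move=> x y cxy; apply: val_inj; apply: (@flow_hausdorff G X).
move=> U V Ux Vy.
have [z [Uz Vz]] := cxy _ _ (val_subflow_continuous Ux) (val_subflow_continuous Vy).
by exists (val z).
Qed.

Lemma subflow_compact : compact [set: S].
Proof.
move=> F PF _.
have cptA : compact A by apply: subclosed_compact cA (@flow_compact G X) _.
have [|x [Ax clx]] := cptA ((val : S -> X) @ F) (fmap_proper_filter _ PF).
  by apply: (@filterS _ F _ setT) filterT => s _ /=; have := valP s; rewrite inE.
exists (exist _ x (mem_set Ax) : S); split=> // P U FP [_ [[W oW <-] Wx WU]].
have FvP : ((val : S -> X) @ F) ((val : S -> X) @` P).
  by apply: (@filterS _ F _ P) FP => s Ps; exists s.
have xW : nbhs x W.
  by apply: open_nbhs_nbhs; split => //; move: Wx; rewrite /= set_valE.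
have [_ [[s Ps <-] Ws]] := clx _ _ FvP xW.
by exists s; split => //; apply: WU.
Qed.

HB.instance Definition _ := isFlow.Build G S
  subflow_act1 subflow_actM subflow_act_continuous subflow_compact
  subflow_hausdorff.

End Subflow.

Section Ellis.
Variables (G : topologicalGroupType) (X : flowType G).

Local Notation XX := (prod_topology (fun _ : X => X)).

Definition ellis_set : set XX := closure (range (fun g : G => act g : XX)).

Lemma closed_ellis_set : closed ellis_set.
Proof. exact: closed_closure. Qed.

Lemma invariant_ellis_set : invariant ellis_set.
Proof. exact: (@invariant_orbit_closure G XX (fun x => x)). Qed.

Definition ellis : Type := subflow closed_ellis_set invariant_ellis_set.

HB.instance Definition _ := Flow.on ellis.

Definition ellis_fun (f : ellis) : X -> X := val f.

Lemma ellis_funP (f : ellis) : ellis_set (ellis_fun f).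
Proof. by have := valP f; rewrite inE. Qed.

Arguments ellis_funP : clear implicits.

Lemma ellis_set1 : ellis_set (fun x => x).
Proof.
by apply: subset_closure; exists 1 => //; apply/funext => x; exact: act1.
Qed.

Lemma ellis_setM (f h : XX) :
  ellis_set f -> ellis_set h -> ellis_set (fun x => f (h x)).
Proof.
move=> Ef Eh; apply: closed_ellis_set => B Bfh.
have Rh : continuous (fun k : XX => (fun x => k (h x)) : XX).
  move=> k; apply: (prod_cvgP _ (fmap_filter _ (nbhs_filter k))).2 => x.
  exact: prod_eval_continuous.
have [_ [[g _ <-] Bgh]] := Ef _ (Rh f _ Bfh).
exists (fun x => act g (h x)); split => //.
exact: (@invariant_ellis_set g h Eh).
Qed.

Definition ellis1 : ellis := exist _ (fun x => x) (mem_set ellis_set1).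

Definition ellis_mul (f h : ellis) : ellis :=
  exist _ (ellis_fun f \o ellis_fun h)
    (mem_set (ellis_setM (ellis_funP f) (ellis_funP h))).

Lemma ellis_mulA : associative ellis_mul.
Proof. by move=> f h k; apply: val_inj. Qed.

Lemma ellis_mul1 : left_id ellis1 ellis_mul.
Proof. by move=> f; apply: val_inj. Qed.

Lemma ellis_1mul : right_id ellis1 ellis_mul.
Proof. by move=> f; apply: val_inj. Qed.

HB.instance Definition _ :=
  isMonoid.Build ellis ellis_mulA ellis_mul1 ellis_1mul.

Definition left_ideal (M : set ellis) : Prop :=
  M !=set0 /\ forall a m, M m -> M (a * m).

Definition minimal_left_ideal (M : set ellis) : Prop :=
  left_ideal M /\ forall N, left_ideal N -> N `<=` M -> N = M.

Definition directed (I : Type) (le : I -> I -> Prop) : Prop :=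
  [/\ inhabited I, forall i, le i i, forall i j k, le i j -> le j k -> le i k
    & forall i j, exists k, le i k /\ le j k].

Definition net_filter (I : Type) (le : I -> I -> Prop) : set_system I :=
  filter_from setT (fun i => [set j | le i j]).

(* act g 1 is the element x |-> g x of the Ellis semigroup, and act g b is its
   product with b (ellis_actE below). *)
Definition circ (a : ellis) (B : set ellis) : set ellis :=
  [set c | exists (I : Type) (le : I -> I -> Prop) (g : I -> G) (b : I -> ellis),
    [/\ directed le, forall i, B (b i),
        act (g i) (1 : ellis) @[i --> net_filter le] --> a
      & act (g i) (b i) @[i --> net_filter le] --> c]].

Lemma circS a (A B : set ellis) : A `<=` B -> circ a A `<=` circ a B.
Proof.
move=> AB c [I [le [g [b [? Ab ? ?]]]]].
by exists I, le, g, b; split => // i; exact: AB.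
Qed.

Lemma circ0 a : circ a set0 = set0.
Proof. by apply/seteqP; split => // c [I [le [g [b [[[i] _ _ _] /(_ i)]]]]]. Qed.

Lemma directed_cofinal I le (P : I -> Prop) : @directed I le ->
  (forall i, exists2 j, le i j & P j) ->
  @directed {i | P i} (fun i j => le (sval i) (sval j)).
Proof.
move=> [[i0] le_refl le_trans le_dir] cofP; split => //.
- by have [j _ Pj] := cofP i0; constructor; exists j.
- by move=> i j k; exact: le_trans.
move=> [i Pi] [j Pj]; have [k [ik jk]] := le_dir i j; have [l kl Pl] := cofP k.
by exists (exist _ l Pl); split; apply: le_trans kl.
Qed.

Lemma cvg_cofinal I le (P : I -> Prop) (T : topologicalType) (u : I -> T) (l : T) :
  @directed I le -> (forall i, exists2 j, le i j & P j) ->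
  u i @[i --> net_filter le] --> l ->
  u (sval k) @[k --> @net_filter {i | P i} (fun i j => le (sval i) (sval j))]
    --> l.
Proof.
move=> [_ _ le_trans _] cofP ul U /ul[i _ iU]; have [j ij Pj] := cofP i.
exists (exist _ j Pj) => // -[k Pk] /= jk; apply: iU; exact: le_trans ij jk.
Qed.

Lemma circU a (A B : set ellis) : circ a (A `|` B) `<=` circ a A `|` circ a B.
Proof.
move=> c [I [le [g [b [dir bAB ga gbc]]]]].
have [cofA|] := pselect (forall i, exists2 j, le i j & A (b j)).
  left; exists {i | A (b i)}, (fun i j => le (sval i) (sval j)), (g \o sval),
    (b \o sval).
  split; [exact: directed_cofinal | by case | | ].
  - exact: (cvg_cofinal dir cofA ga).
  - exact: (cvg_cofinal dir cofA gbc).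
move=> /existsNP[i0 ni0]; right.
have cofB i : exists2 j, le i j & B (b j).
  have [_ _ le_trans le_dir] := dir.
  have [j [ij i0j]] := le_dir i i0; exists j => //.
  by have [Aj|//] := bAB j; case: ni0; exists j.
exists {i | B (b i)}, (fun i j => le (sval i) (sval j)), (g \o sval),
  (b \o sval).
split; [exact: directed_cofinal | by case | | ].
- exact: (cvg_cofinal dir cofB ga).
- exact: (cvg_cofinal dir cofB gbc).
Qed.

Lemma circP a (B : set ellis) c :
  circ a B c <->
  forall W V, nbhs a W -> nbhs c V ->
    exists g b, [/\ B b, W (act g (1 : ellis)) & V (act g b)].
Proof.
split=> [[I [le [g [b [[_ le_refl _ le_dir] bB ga gbc]]]]] W V aW cV|acP].
  have [i _ iW] := ga _ aW; have [j _ jV] := gbc _ cV.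
  have [k [ik jk]] := le_dir i j.
  by exists (g k), (b k); split; [exact: bB|exact: iW|exact: jV].
pose I := {WV : set ellis * set ellis | nbhs a WV.1 /\ nbhs c WV.2}.
have gbP (i : I) : exists gb : G * ellis,
    [/\ B gb.2, (sval i).1 (act gb.1 (1 : ellis)) & (sval i).2 (act gb.1 gb.2)].
  case: i => -[W V] /= [aW cV]; have [g [b gbB]] := acP W V aW cV.
  by exists (g, b).
have [gb {}gbP] := choice gbP.
have nT (x : ellis) : nbhs x setT by exact: filterT.
exists I, (fun i j => (sval j).1 `<=` (sval i).1 /\ (sval j).2 `<=` (sval i).2),
  (fun i => (gb i).1), (fun i => (gb i).2); split.
- split.
  + by constructor; exists (setT, setT).
  + by move=> i; split.
  + move=> i j k [ij1 ij2] [jk1 jk2].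
    by split; [exact: subset_trans jk1 ij1|exact: subset_trans jk2 ij2].
  + move=> [[W V] /= [aW cV]] [[W' V'] /= [aW' cV']].
    have nI : nbhs a (W `&` W', V `&` V').1 /\ nbhs c (W `&` W', V `&` V').2.
      by split; exact: filterI.
    by exists (exist _ (W `&` W', V `&` V') nI); split => /=; split => x [].
- by move=> i; have [] := gbP i.
- move=> W aW; exists (exist _ (W, setT) (conj aW (nT c))) => // i [iW _].
  by have [_ /iW ? _] := gbP i.
- move=> V cV; exists (exist _ (setT, V) (conj (nT a) cV)) => // i [_ iV].
  by have [_ _ /iV ?] := gbP i.
Qed.

Lemma ellis_mulr_continuous (b : ellis) : continuous (fun a : ellis => a * b).
Proof.
apply: (@continuous_comp_initial (set_type ellis_set) ellis XX set_val).
move=> a; apply: (prod_cvgP _ (fmap_filter _ (nbhs_filter a))).2 => x.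
apply: (@continuous_comp _ _ _ (val : ellis -> XX)
  (fun k : XX => k (ellis_fun b x))).
  exact: val_subflow_continuous.
exact: prod_eval_continuous.
Qed.

Lemma ellis_actE (g : G) (b : ellis) : act g b = act g (1 : ellis) * b.
Proof. by apply: val_inj. Qed.

Lemma ellis_dense (a : ellis) W : nbhs a W -> exists g, W (act g (1 : ellis)).
Proof.
move=> [_ [[V oV <-] Va VW]].
have aV : nbhs (ellis_fun a : XX) V by apply: open_nbhs_nbhs.
have [_ [[g _ <-] Vg]] := ellis_funP a _ aV.
by exists g; apply: VW.
Qed.

Lemma circ_circ a b (C : set ellis) : circ a (circ b C) `<=` circ (a * b) C.
Proof.
move=> c /circP abCc; apply/circP => W V abW cV.
have [g [d [/circP bCd Wgb Vgd]]] :=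
  abCc _ _ (ellis_mulr_continuous (nbhs_interior abW)) (nbhs_interior cV).
rewrite /= -ellis_actE in Wgb.
have [h [e [Ce Wghb Vghe]]] := bCd _ _ (act_cts Wgb) (act_cts Vgd).
by exists (g * h), e; split; rewrite ?actM.
Qed.

Lemma circ_mul a b (B : set ellis) : B b -> circ a B (a * b).
Proof.
move=> Bb; apply/circP => W V aW abV.
have [g [Wg Vgb]] := ellis_dense (filterI aW (ellis_mulr_continuous abV)).
by exists g, b; split => //; rewrite ellis_actE.
Qed.

(* The carrier is u M; the proofs are arguments because the group structure
   depends on them. It does not inherit the topology of ellis X: its topology is
   the tau-topology, whose closure operator is cl_tau (closure_tau below). *)
Definition ellis_group (M : set ellis) (u : ellis)
    (minM : minimal_left_ideal M) (Mu : M u) (uu : u * u = u) : Type :=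
  set_type [set u * m | m in M].

End Ellis.

Section EllisGroup.
Variables (G : topologicalGroupType) (X : flowType G).
Variables (M : set (ellis X)) (u : ellis X).
Hypotheses (minM : minimal_left_ideal M) (Mu : M u) (uu : u * u = u).

Local Notation T := (ellis_group minM Mu uu).

HB.instance Definition _ := SubType.on T.
HB.instance Definition _ := Choice.on T.

Lemma ellis_groupP (p : T) : exists2 m, M m & u * m = val p.
Proof. by have := valP p; rewrite inE. Qed.

Lemma ellis_group_ideal (p : T) : M (val p).
Proof.
by have [m Mm <-] := ellis_groupP p; have [[_ idM] _] := minM; exact: idM.
Qed.

Lemma ellis_group_mull (p : T) : u * val p = val p.
Proof. by have [m Mm <-] := ellis_groupP p; rewrite mulgA uu. Qed.

Lemma minimal_ideal_solve p q : M p -> M q -> exists2 m, M m & m * p = q.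
Proof.
have [[M0 idM] minM'] := minM; move=> Mp Mq.
suff E : [set m * p | m in M] = M by move: Mq; rewrite -{1}E.
apply: minM' => [|_ [m Mm <-]]; last exact: idM.
split; first by exists (u * p); exists u.
by move=> a _ [m Mm <-]; exists (a * m); [exact: idM|rewrite mulgA].
Qed.

Lemma ellis_group_mulr (p : T) : val p * u = val p.
Proof.
have [m _ <-] := minimal_ideal_solve Mu (ellis_group_ideal p).
by rewrite -mulgA uu.
Qed.

Lemma ellis_group_mul_subproof (p q : T) :
  val p * val q \in [set u * m | m in M].
Proof.
have [[_ idM] _] := minM; apply/mem_set; exists (val p * val q).
  exact/idM/ellis_group_ideal.
by rewrite mulgA ellis_group_mull.
Qed.

Definition ellis_group_mul (p q : T) : T :=
  exist _ (val p * val q) (ellis_group_mul_subproof p q).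

Lemma ellis_group_one_subproof : u \in [set u * m | m in M].
Proof. by apply/mem_set; exists u. Qed.

Definition ellis_group_one : T := exist _ u ellis_group_one_subproof.

Lemma ellis_group_mulA : associative ellis_group_mul.
Proof. by move=> p q r; apply: val_inj; rewrite /= mulgA. Qed.

Lemma ellis_group_mul1 : left_id ellis_group_one ellis_group_mul.
Proof. by move=> p; apply: val_inj; exact: ellis_group_mull. Qed.

Lemma ellis_group_1mul : right_id ellis_group_one ellis_group_mul.
Proof. by move=> p; apply: val_inj; exact: ellis_group_mulr. Qed.

Lemma ellis_group_left_inverse (p : T) :
  exists q, ellis_group_mul q p = ellis_group_one.
Proof.
have [m Mm mp] := minimal_ideal_solve (ellis_group_ideal p) Mu.
have um : u * m \in [set u * m | m in M] by apply/mem_set; exists m.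
by exists (exist _ (u * m) um); apply: val_inj; rewrite /= -mulgA mp.
Qed.

Definition ellis_group_inv (p : T) : T :=
  projT1 (cid (ellis_group_left_inverse p)).

Lemma ellis_group_mulV :
  left_inverse ellis_group_one ellis_group_inv ellis_group_mul.
Proof. by move=> p; rewrite /ellis_group_inv; case: cid. Qed.

Lemma ellis_group_Vmul :
  right_inverse ellis_group_one ellis_group_inv ellis_group_mul.
Proof.
move=> p; set q := ellis_group_inv p; set r := ellis_group_inv q.
have rq : ellis_group_mul r q = ellis_group_one by exact: ellis_group_mulV.
have qp : ellis_group_mul q p = ellis_group_one by exact: ellis_group_mulV.
have -> : p = r; last exact: rq.
by rewrite -[p]ellis_group_mul1 -rq -ellis_group_mulA qp ellis_group_1mul.
Qed.

HB.instance Definition _ := isGroup.Build T ellis_group_mulA ellis_group_mul1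
  ellis_group_1mul ellis_group_mulV ellis_group_Vmul.

Definition cl_tau (B : set T) : set T :=
  [set p | circ u [set val b | b in B] (val p)].

Definition tau_open (U : set T) : Prop := cl_tau (~` U) `<=` ~` U.

Lemma cl_tauS (A B : set T) : A `<=` B -> cl_tau A `<=` cl_tau B.
Proof. by move=> AB p; apply: circS => _ [b /AB Bb <-]; exists b. Qed.

Lemma tau_openT : tau_open setT.
Proof. by rewrite /tau_open setCT => p; rewrite /cl_tau /= image_set0 circ0. Qed.

Lemma tau_openI : setI_closed tau_open.
Proof.
move=> U V oU oV p; rewrite /cl_tau /= setCI image_setU => /circU[].
  by move=> /oU nU [Up _].
by move=> /oV nV [_ Vp].
Qed.

Lemma tau_open_bigU (I : Type) (f : I -> set T) :
  (forall i, tau_open (f i)) -> tau_open (\bigcup_i f i).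
Proof.
move=> of_ p clp [i _ fip]; apply: (of_ i p) fip; apply: cl_tauS clp.
by apply: subsetC; exact: bigcup_sup.
Qed.

HB.instance Definition _ :=
  isOpenTopological.Build T tau_openT tau_openI tau_open_bigU.

Lemma subset_cl_tau (B : set T) : B `<=` cl_tau B.
Proof.
by move=> p Bp; rewrite /cl_tau /= -ellis_group_mull; apply: circ_mul; exists p.
Qed.

Lemma cl_tau_idem (B : set T) : cl_tau (cl_tau B) `<=` cl_tau B.
Proof.
move=> p clp.
have : circ (u * u) [set val b | b in B] (val p).
  by apply/circ_circ; apply: circS clp => _ [q clq <-].
by rewrite uu.
Qed.

Lemma closure_tau (B : set T) : closure B = cl_tau B.
Proof.
have clE (C : set T) : closed C <-> cl_tau C `<=` C.
  by rewrite -openC; rewrite /open /= /tau_open setCK.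
apply/seteqP; split.
  rewrite closureE; apply: smallest_sub; last exact: subset_cl_tau.
  by apply/clE; exact: cl_tau_idem.
move=> p clp; apply: ((clE _).1 (@closed_closure T B)).
by apply: cl_tauS clp; exact: subset_closure.
Qed.

Definition ellis_group_H : set T :=
  \bigcap_(U in [set U : set T | open U /\ U 1]) cl_tau U.

End EllisGroup.

Arguments ellis_group {G X M u} minM Mu uu.
Arguments ellis_group_H {G X M u} minM Mu uu.

(* A choice of M and u exists in every flow, and the isomorphism type of the group
   does not depend on it. *)
Definition finite_ellis_group (G : topologicalGroupType) (X : flowType G) :
    Prop :=
  exists (M : set (ellis X)) (u : ellis X) (minM : minimal_left_ideal M)
    (Mu : M u) (uu : u * u = u),
    finite_set [set: ellis_group minM Mu uu].

Definition profinite_group (P : preTopologicalGroupType) : Prop :=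
  [/\ continuous (fun xy : P * P => xy.1 * xy.2),
      continuous (fun x : P => x^-1),
      compact [set: P], hausdorff_space P & totally_disconnected [set: P]].

(* Q, with projection pi, is the topological quotient group P / N; this forces N to
   be a normal subgroup and determines Q up to isomorphism. *)
Definition quotient_group (P Q : preTopologicalGroupType) (N : set P)
    (pi : P -> Q) : Prop :=
  [/\ forall y, exists x, pi x = y, {morph pi : x y / x * y},
      forall x, pi x = 1 <-> N x
    & forall V : set Q, open V <-> open (pi @^-1` V)].

Definition profinite_quotient (P : preTopologicalGroupType) (N : set P) : Prop :=
  exists (Q : preTopologicalGroupType) (pi : P -> Q),
    quotient_group N pi /\ profinite_group Q.

Section Bohr.
Variables (G : topologicalGroupType) (Y : flowType G) (y0 : Y).

(* f is the epimorphism of ambits onto K, on which g acts as left multiplication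
   by h g. Continuity of h follows from the factorization. *)
Definition compactification_below (K : topologicalGroupType) (h : G -> K) :
    Prop :=
  [/\ compact [set: K], hausdorff_space K, {morph h : a b / a * b},
      dense (range h)
    & exists f : Y -> K,
        [/\ continuous f, forall k, exists y, f y = k, f y0 = 1,
            forall g y, f (act g y) = h g * f y
          & forall g, h g = f (act g y0)]].

Definition bohr_below (K : topologicalGroupType) (b : G -> K) : Prop :=
  compactification_below b /\
  forall (L : topologicalGroupType) (h : G -> L), compactification_below h ->
    exists! phi : K -> L,
      [/\ continuous phi, {morph phi : x y / x * y} & h = phi \o b].

Definition profinite_bohr_below : Prop :=
  exists (K : topologicalGroupType) (b : G -> K),
    bohr_below b /\ profinite_group K.

End Bohr.

Section InverseLimit.
Variable G : topologicalGroupType.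

(* bond_id and bond_comp make bond ij independent of the order proof ij. *)
Record inverse_system := InverseSystem {
  sys_index : Type;
  sys_le : sys_index -> sys_index -> Prop;
  sys_directed : directed sys_le;
  stage : sys_index -> flowType G;
  bond : forall i j, sys_le i j -> stage j -> stage i;
  bond_continuous : forall i j (ij : sys_le i j), continuous (bond ij);
  bond_act : forall i j (ij : sys_le i j) g x,
    bond ij (act g x) = act g (bond ij x);
  bond_id : forall i (ii : sys_le i i) x, bond ii x = x;
  bond_comp : forall i j k (ij : sys_le i j) (jk : sys_le j k)
    (ik : sys_le i k) x, bond ij (bond jk x) = bond ik x
}.

Variable S : inverse_system.

Local Notation P := (prod_topology (@stage S)).

Definition threads : set P :=
  [set x | forall i j (ij : sys_le i j), bond ij (x j) = x i].

Lemma closed_threads : closed threads.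
Proof.
move=> x clx i j ij.
apply: (@flow_hausdorff G (stage i)) => U V xU xV.
have cj : continuous (fun y : P => bond ij (y j)).
  move=> y; apply: (@continuous_comp _ _ _ (fun z : P => z j) (bond ij)).
    exact: prod_eval_continuous.
  exact: bond_continuous.
have ci : continuous (fun y : P => y i) by exact: prod_eval_continuous.
have nUV : nbhs x ([set y : P | U (bond ij (y j))] `&` [set y : P | V (y i)]).
  by apply: filterI; [exact: (cj x _ xU)|exact: (ci x _ xV)].
have [y [yP [/= Uy Vy]]] := clx _ nUV.
by exists (y i); split => //; rewrite -(yP i j ij).
Qed.

Lemma invariant_threads : invariant threads.
Proof.
by move=> g x xP i j ij; rewrite /act /= /prod_act bond_act xP.
Qed.

Definition inverse_limit : Type := subflow closed_threads invariant_threads.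

HB.instance Definition _ := Flow.on inverse_limit.

End InverseLimit.

Definition flow_iso (G : topologicalGroupType) (X Y : flowType G) : Prop :=
  exists (f : X -> Y) (f' : Y -> X),
    [/\ cancel f f', cancel f' f, continuous f, continuous f'
      & forall g x, f (act g x) = act g (f x)].

Section StoneSpace.
Variables (G : topologicalGroupType) (X : flowType G).

Definition translate (g : G) (U : set X) : set X := [set act g x | x in U].

Definition set_orbit (U : set X) : set (set X) :=
  [set translate g U | g in [set: G]].

Definition clopen_orbits : set (set (set X)) :=
  [set set_orbit U | U in [set U : set X | clopen U]].

Definition boolean_G_algebra (A : set (set X)) : Prop :=
  [/\ A set0, forall U, A U -> A (~` U), setU_closed A
    & forall g U, A U -> A (translate g U)].

Definition generated_G_algebra (D : set (set (set X))) : set (set X) :=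
  smallest boolean_G_algebra (\bigcup_(O in D) O).

(* Points of the Stone space of A: the ultrafilters of the Boolean algebra A, not
   ultrafilters on X. *)
Definition ultrafilter_on (A : set (set X)) (p : set (set X)) : Prop :=
  [/\ p `<=` A, p setT /\ ~ p set0, setI_closed p,
      forall U V, p U -> A V -> U `<=` V -> p V
    & forall U, A U -> p U \/ p (~` U)].

(* The inclusion in clopen_orbits X is needed for the action to be continuous. *)
Definition stone (D : set (set (set X))) (clD : D `<=` clopen_orbits) : Type :=
  set_type [set p | ultrafilter_on (generated_G_algebra D) p].

End StoneSpace.

Section StoneFlow.
Variables (G : topologicalGroupType) (X : flowType G).
Variables (D : set (set (set X))) (clD : D `<=` @clopen_orbits G X).

Local Notation A := (generated_G_algebra D).
Local Notation S := (stone clD).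

HB.instance Definition _ := SubType.on S.
HB.instance Definition _ := Choice.on S.

Lemma stoneP (p : S) : ultrafilter_on A (val p).
Proof. by have := valP p; rewrite inE. Qed.

Lemma mem_translate (g : G) (U : set X) : translate g U = act g^-1 @^-1` U.
Proof.
apply/seteqP; split=> [_ [x Ux <-] /=|x /= Ux]; first by rewrite actK.
by exists (act g^-1 x) => //; rewrite actVK.
Qed.

Lemma translate1 (U : set X) : translate 1 U = U.
Proof. by rewrite mem_translate invg1; apply/seteqP; split=> x /=; rewrite act1. Qed.

Lemma translateM g h (U : set X) : translate (g * h) U = translate g (translate h U).
Proof.
by rewrite !mem_translate invgM; apply/seteqP; split=> x /=; rewrite actM.
Qed.

Lemma translateI g (U V : set X) :
  translate g (U `&` V) = translate g U `&` translate g V.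
Proof. by rewrite !mem_translate preimage_setI. Qed.

Lemma translateC g (U : set X) : translate g (~` U) = ~` translate g U.
Proof. by rewrite !mem_translate preimage_setC. Qed.

Lemma translateT g : translate g [set: X] = setT.
Proof. by rewrite mem_translate preimage_setT. Qed.

Lemma translate0 g : translate g (@set0 X) = set0.
Proof. by rewrite mem_translate preimage_set0. Qed.

Lemma generated_G_algebraP : boolean_G_algebra A.
Proof.
split.
- by move=> B [[]].
- by move=> U AU B BD; have [[_ BC _ _] _] := BD; exact: (BC _ (AU _ BD)).
- move=> U V AU AV B BD; have [[_ _ BU _] _] := BD.
  exact: (BU _ _ (AU _ BD) (AV _ BD)).
- by move=> g U AU B BD; have [[_ _ _ Bg] _] := BD; exact: (Bg _ _ (AU _ BD)).
Qed.

Lemma generated_G_algebraT : A setT.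
Proof.
by have [A0 AcC _ _] := generated_G_algebraP; rewrite -setC0; exact: AcC.
Qed.

Lemma generated_G_algebraI : setI_closed A.
Proof.
have [_ AcC AU _] := generated_G_algebraP => U V /AcC AnU /AcC AnV.
by rewrite -[U `&` V]setCK setCI; exact: (AcC _ (AU _ _ AnU AnV)).
Qed.

Lemma clopen_translate g (U : set X) : clopen U -> clopen (translate g U).
Proof.
have cg : continuous (act g^-1 : X -> X) by exact: act_cts.
by move=> [oU cU]; rewrite mem_translate; split;
  [move/continuousP: cg|move/continuous_closedP: cg]; apply.
Qed.

Lemma generated_G_algebra_clopen : A `<=` clopen.
Proof.
apply: smallest_sub.
  split=> [|U [oU cU]|U V [oU cU] [oV cV]|]; last exact: clopen_translate.
  - by split; [exact: open0|exact: closed0].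
  - by split; [exact: closed_openC|exact: open_closedC].
  - by split; [exact: openU|exact: closedU].
move=> U [O /clD[V cV <-]] [g _ <-]; exact: clopen_translate.
Qed.

Lemma stone_act_subproof (g : G) (p : S) :
  [set translate g U | U in val p] \in [set p | ultrafilter_on A p].
Proof.
have [pA [pT p0] pI pS pC] := stoneP p.
have [_ _ _ Ag] := generated_G_algebraP.
apply/mem_set; split.
- by move=> _ [U pU <-]; exact: (Ag _ _ (pA _ pU)).
- split; first by exists setT => //; exact: translateT.
  move=> [U pU U0]; apply: p0; suff <- : U = set0 by [].
  by rewrite -[U]translate1 -(mulVg g) translateM U0 translate0.
- move=> _ _ [U pU <-] [V pV <-]; exists (U `&` V); first exact: pI.
  exact: translateI.
- move=> _ V [U pU <-] AV UV; exists (translate g^-1 V); last first.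
    by rewrite -translateM mulgV translate1.
  apply: (pS U) => //; first exact: Ag.
  by rewrite mem_translate invgK => x Ux; apply: UV; exists x.
- move=> U AU; have [pU|pU] := pC _ (Ag g^-1 _ AU); [left|right].
    by exists (translate g^-1 U) => //; rewrite -translateM mulgV translate1.
  exists (~` translate g^-1 U) => //.
  by rewrite -translateC -translateM mulgV translate1.
Qed.

Definition stone_act (g : G) (p : S) : S :=
  exist _ [set translate g U | U in val p] (stone_act_subproof g p).

Lemma stone_act1 p : stone_act 1 p = p.
Proof.
apply: val_inj; apply/seteqP; split=> [_ [U pU <-]|U pU].
  by rewrite translate1.
by exists U => //; exact: translate1.
Qed.

Lemma stone_actM g h p : stone_act (g * h) p = stone_act g (stone_act h p).
Proof.
apply: val_inj; apply/seteqP; split=> [_ [U pU <-]|_ [_ [U pU <-] <-]].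
  by exists (translate h U); [exists U|rewrite translateM].
by exists U => //; rewrite translateM.
Qed.

Definition stone_base (U : set X) : set S := [set p | val p U].

Lemma stone_base_cover : \bigcup_(U in A) stone_base U = setT.
Proof.
apply/seteqP; split => // p _; exists setT; first exact: generated_G_algebraT.
by have [_ []] := stoneP p.
Qed.

Lemma stone_base_join U V (p : S) :
  A U -> A V -> stone_base U p -> stone_base V p ->
  exists W, [/\ A W, stone_base W p
    & stone_base W `<=` stone_base U `&` stone_base V].
Proof.
move=> AU AV pU pV; exists (U `&` V); split.
- exact: generated_G_algebraI.
- by have [_ _ pI _ _] := stoneP p; exact: pI.
- move=> q qUV; have [_ _ _ qS _] := stoneP q.
  by split; [apply: qS qUV AU _; exact: subIsetl
            |apply: qS qUV AV _; exact: subIsetr].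
Qed.

HB.instance Definition _ :=
  isBaseTopological.Build S stone_base_cover stone_base_join.

Lemma stone_nbhsP (p : S) (W : set S) :
  nbhs p W <-> exists2 U, val p U & stone_base U `<=` W.
Proof.
split=> [[_ [[B BA <-] [U BU pU] UW]]|[U pU UW]].
  by exists U => // q qU; apply: UW; exists U.
have [pA _ _ _ _] := stoneP p; exists (stone_base U); split => //.
exists [set U]; first by move=> _ ->; exact: pA.
by rewrite bigcup_set1.
Qed.

Lemma stone_hausdorff : hausdorff_space S.
Proof.
suff sub (p q : S) : (nbhs p `#` nbhs q) -> val p `<=` val q.
  move=> p q clpq; apply: val_inj; apply/seteqP.
  by split; apply: sub => // U V qU pV; rewrite setIC; exact: clpq.
move=> clpq U pU; have [pA _ _ _ _] := stoneP p.
have [_ _ _ _ qC] := stoneP q; have [//|qU] := qC _ (pA _ pU).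
have [r [rU rnU]] := clpq _ _ ((stone_nbhsP p _).2 (ex_intro2 _ _ U pU (fun _ h => h)))
  ((stone_nbhsP q _).2 (ex_intro2 _ _ _ qU (fun _ h => h))).
have [_ [_ r0] rI _ _] := stoneP r.
by case: r0; rewrite -(setICr U); exact: rI.
Qed.

Lemma stone_point_subproof (x : X) :
  [set U | A U /\ U x] \in [set p | ultrafilter_on A p].
Proof.
have [A0 AcC AU _] := generated_G_algebraP.
apply/mem_set; split => [U []//|||U V [_ Ux] AV UV|U AUU].
- by split=> [|[]//]; split => //; exact: generated_G_algebraT.
- by move=> U V [AU' Ux] [AV Vx]; split => //; exact: generated_G_algebraI.
- by split => //; exact: UV.
- by have [Ux|nUx] := pselect (U x); [left|right]; split => //; exact: AcC.
Qed.

Definition stone_point (x : X) : S := 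
  exist _ [set U | A U /\ U x] (stone_point_subproof x).

Lemma stone_point_continuous : continuous stone_point.
Proof.
move=> x W /stone_nbhsP[U [AU Ux] UW].
have [oU _] := generated_G_algebra_clopen AU.
by apply: filterS (open_nbhs_nbhs (conj oU Ux)) => y Uy; apply: UW; split.
Qed.

Lemma stone_point_surj (p : S) : exists x, stone_point x = p.
Proof.
have [pA [pT p0] pI pS pC] := stoneP p.
have PF : ProperFilter (filter_from (val p) id).
  apply: filter_from_proper.
    apply: filter_from_filter; first by exists setT.
    by move=> U V pU pV; exists (U `&` V) => //; exact: pI.
  move=> U pU; apply/set0P/eqP => U0; apply: p0.
  by rewrite -U0.
have [x [_ clx]] := @flow_compact G X _ PF filterT.
exists x; apply: val_inj.
have px U : val p U -> U x.
  move=> pU; have [_ cU] := generated_G_algebra_clopen (pA _ pU).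
  by apply: cU => V xV; apply: clx => //; exists U.
apply/seteqP; split => [U [AU Ux]|U pU]; last by split; [exact: pA|exact: px].
by have [//|/px] := pC _ AU.
Qed.

Lemma stone_compact : compact [set: S].
Proof.
have <- : stone_point @` setT = setT.
  by apply/seteqP; split=> // p _; have [x <-] := stone_point_surj p; exists x.
apply: continuous_compact; last exact: flow_compact.
by apply: continuous_subspaceT; exact: stone_point_continuous.
Qed.

Lemma clopen_near_translate (g : G) (U : set X) : clopen U ->
  \forall h \near g, act h @^-1` U = act g @^-1` U.
Proof.
move=> [oU cU].
have /compact_near_coveringP cpt := @flow_compact G X.
have : \forall h \near g, [set: X] `<=` (fun x => U (act h x) <-> U (act g x)).
  apply: cpt => x _.
  have act_near (V : set X) : open V -> V (act g x) ->
      \forall y \near x & h \near g, V (act h y) /\ V (act g y).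
    move=> oV Vgx.
    have nV : nbhs (act g x) V by exact: open_nbhs_nbhs.
    have [[/= P Q] [gP xQ] PQ] := @act_continuous G X (g, x) _ nV.
    exists (Q, P) => // -[y h] /= [Qy Ph]; split; first exact: (PQ (h, y)).
    by apply: (PQ (g, y)); split => //; exact: nbhs_singleton.
  have [Ugx|nUgx] := pselect (U (act g x)).
    by apply: filterS (act_near _ oU Ugx) => -[y h] /= [].
  have oUC : open (~` U) by exact: closed_openC.
  by apply: filterS (act_near _ oUC nUgx) => -[y h] /= [].
by apply: filterS => h hU; apply/seteqP; split => x /= ; have [] := hU x Logic.I; auto.
Qed.

Lemma mem_stone_act g (p : S) (U : set X) :
  val (stone_act g p) U <-> val p (act g @^-1` U).
Proof.
split=> [[V pV <-]|pU].
  by rewrite -[g in act g]invgK -mem_translate -translateM mulVg translate1.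
exists (act g @^-1` U) => //.
by rewrite -[g in act g]invgK -mem_translate -translateM mulgV translate1.
Qed.

Lemma stone_act_continuous :
  continuous (fun gp : (G * S)%type => stone_act gp.1 gp.2).
Proof.
move=> [g p] W /stone_nbhsP[U /mem_stone_act pU UW].
have [gpA _ _ _ _] := stoneP (stone_act g p).
have clU : clopen U.
  exact: (generated_G_algebra_clopen (gpA _ ((mem_stone_act _ _ _).2 pU))).
exists ([set h | act h @^-1` U = act g @^-1` U], stone_base (act g @^-1` U)).
  split; first exact: clopen_near_translate.
  by apply/stone_nbhsP; exists (act g @^-1` U).
by move=> [h q] /= [hU qU]; apply/UW/mem_stone_act; rewrite hU.
Qed.

HB.instance Definition _ := isFlow.Build G S
  stone_act1 stone_actM stone_act_continuous stone_compact stone_hausdorff.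

End StoneFlow.

Arguments clopen_orbits {G} X.

(* Main.v *)
Require Import Defs.
From HB Require Import structures.
From mathcomp Require Import all_boot fingroup perm generic_quotient.
From mathcomp Require Import all_classical topology.

Set Implicit Arguments.
Unset Strict Implicit.
Unset Printing Implicit Defensive.

Local Open Scope classical_set_scope.
Local Open Scope group_scope.

(** Three devices carry the chain of implications.

    Limits along ultrafilters. Every point of an orbit closure is a limit of
    the orbit along an ultrafilter on G (orbit_ultra), and along a fixed
    ultrafilter everything in a compact flow converges. Hence an ultrafilter
    acts at once on all flows, compatibly with all equivariant continuous maps
    (equivariant_limit). If f : W -> Z and q : W -> Y are such maps, q is
    surjective and q factors through f, the action of an ultrafilter on Z thus
    determines its action on Y, which is a surjective homomorphism
    E(Z) -> E(Y) (ellis_hom_exists). A surjective homomorphism maps minimal left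
    ideals to minimal left ideals and so Ellis groups onto Ellis groups
    (finite_ellis_group_image).

    Closed graphs. A map into a compact space K is continuous as soon as its
    composites with enough continuous maps on K to separate points are
    (separated_continuous). All topological group structures below are obtained
    in this way.

    Images of profinite groups. A compact Hausdorff group that is a continuous
    homomorphic image of a profinite group is profinite (profinite_image),
    because open subgroups form a neighbourhood basis of 1 in a profinite group
    and their images are open subgroups.

    D implies C: let eta have the smallest possible number n of values. Every
    element of the Ellis semigroup is then injective on the image s of eta, so
    the elements eta a permute the finite set s and have powers that are the
    identity on s. It follows that E eta is a minimal left ideal, that a power of
    eta is an idempotent in it, and that its Ellis group embeds in the maps
    s -> s (finite_image_ellis_group).

    C implies B: the flows S_Delta(X), with Delta finite, form an inverse system
    with limit X, the clopen sets of X separating its points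
    (flow_iso_stone_limit). B implies C: each clopen subset of an inverse limit,
    and with it all its translates, is the preimage of a subset of a single
    stage. So S_Delta(X) with Delta finite is a factor of the image of X in some
    stage (stone_factor_stage), and its Ellis group is finite.

    B implies A, by way of C: the tau-topology is compact (tau_compact) and T1,
    hence discrete on a finite Ellis group. The homomorphisms from uM to the
    Ellis groups of the flows S_Delta(X) are tau-continuous and separate the
    points of uM, which makes uM profinite (stone_finite_ellis_profinite).

    A implies A': a Hausdorff topology on uM forces H(uM) = 1.

    A' implies A'': a map E(X) -> K that exhibits a compactification is a
    semigroup homomorphism sending u to 1. Its restriction to uM is a
    tau-continuous epimorphism, and it kills H(uM) because K is Hausdorff; so K
    is an image of uM/H(uM). A'' implies A''': a compactification below
    (X, x0) is also one below (E(X), id), so the Bohr compactification below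
    (X, x0) is an image of the one below (E(X), id). For both steps the Bohr
    compactification below an arbitrary ambit (Y, y0) is constructed as the
    quotient of Y that identifies points with the same image under all
    equivariant maps to Hausdorff groups (bohr_group_below). Multiplication
    passes to this quotient: if g y0 tends to y, then g z tends to a point whose
    image under each such map is the product of the images of y and z. *)

(** * Compact spaces *)

Lemma compact_cluster_open (T : topologicalType) (F : set_system T)
    (FF : Filter F) (U : set T) :
  compact [set: T] -> open U -> cluster F `<=` U -> F U.
Proof.
move=> cT oU clFU; apply: contrapT => nFU.
have PF : ProperFilter (within (~` U) F).
  split; last exact: within_filter.
  by rewrite /within /= => FnU; apply: nFU; apply: filterS FnU => x /contrapT.
have [x [_ clx]] := cT _ PF filterT.
have Ux : U x.
  by apply: clFU => A B FA Bx; apply: clx => //; apply: filterS FA => y Ay.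
have FnU : within (~` U) F (~` U) by exact: withinT.
have [y [nUy Uy]] := clx _ _ FnU (open_nbhs_nbhs (conj oU Ux)).
exact: nUy.
Qed.

(** Any cluster point of m along the neighbourhoods of t has the same image
    under every f as m t, so it is m t; compactness turns a unique cluster point
    into a limit. *)
Lemma separated_continuous (T K : topologicalType) (m : T -> K) :
  compact [set: K] ->
  (forall y z : K, (forall (L : topologicalType) (f : K -> L),
     hausdorff_space L -> continuous f -> continuous (f \o m) -> f y = f z) ->
   y = z) ->
  continuous m.
Proof.
move=> cK sep t U /nbhs_interior /= mU.
suff : (m @ t) U° by apply: filterS; exact: interior_subset.
apply: compact_cluster_open => //; first exact: open_interior.
move=> y cly; suff -> : y = m t by exact: nbhs_singleton.
apply: sep => L f hL cf cfm; apply/esym/hL => A B nA nB.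
have [z [Az Bz]] := cly _ _ (cfm t _ nA : (m @ t) (f @^-1` A)) (cf y _ nB).
by exists (f z).
Qed.

(** In a compact Hausdorff space the quasi-component of a point, that is the
    intersection Z of its clopen neighbourhoods, is connected. Z is the
    cluster set of the filter of these neighbourhoods. *)
Lemma totally_disconnected_zero_dimensional (T : topologicalType) :
  compact [set: T] -> hausdorff_space T -> totally_disconnected [set: T] ->
  zero_dimensional T.
Proof.
move=> cT hT tdT x y /eqP nxy.
pose F := filter_from [set D : set T | clopen D /\ D x] id.
have FF : Filter F.
  apply: filter_from_filter; first by exists setT; split => //; exact: clopenT.
  by move=> A B [? ?] [? ?]; exists (A `&` B) => //; split; [exact: clopenI|split].
pose Z := cluster F.
have ZE z : Z z <-> forall D, clopen D -> D x -> D z.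
  split=> [clz D clD Dx|ZD A B [D [clD Dx] DA] zB].
    by apply: clD.2 => B zB; apply: clz zB; exists D.
  by exists z; split; [exact: DA _ (ZD _ clD Dx)|exact: nbhs_singleton].
have Zx : Z x by apply/ZE.
have cZ : closed Z.
  move=> z clz; apply/ZE => D clD Dx; apply: clD.2 => B zB.
  by have [w [/ZE Zw Bw]] := clz _ zB; exists w; split => //; exact: Zw.
(* Separate the closed pieces P and Q of Z by disjoint open sets U and V. By
   compactness some clopen neighbourhood D of x lies in the union of U and V, and
   then the part of D in U is clopen too, so it contains Z and Q is empty. *)
have split_Z (P Q : set T) : closed P -> closed Q -> P `&` Q = set0 ->
    Z = P `|` Q -> P x -> Q = set0.
  move=> cP cQ PQ0 ZPQ Px.
  have [U [V [oU oV PU QV UV0]]] : exists U V : set T,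
      [/\ open U, open V, P `<=` U, Q `<=` V & U `&` V = set0].
    have nQ : set_nbhs P (~` Q).
      move=> p Pp; apply: open_nbhs_nbhs; split; first exact: closed_openC.
      by move=> Qp; rewrite -[False]/(set0 p) -PQ0.
    have [C nPC CQ] := compact_normal hT cT cP nQ.
    exists C°, (~` closure C); split.
    - exact: open_interior.
    - by apply: closed_openC; exact: closed_closure.
    - by move=> p /nPC.
    - by move=> q Qq /CQ.
    - apply/seteqP; split=> // p [/interior_subset Cp]; apply.
      exact: subset_closure.
  have [D [[oD cD] Dx] DUV] : F (U `|` V).
    apply: compact_cluster_open => //; first exact: openU.
    by rewrite -/Z ZPQ => z [/PU|/QV]; [left|right].
  have clDU : clopen (D `&` U).
    split; first exact: openI.
    suff -> : D `&` U = D `&` ~` V by apply: closedI => //; exact: open_closedC.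
    apply/seteqP; split=> z [Dz].
      by move=> Uz; split=> // Vz; rewrite -[False]/(set0 z) -UV0.
    by move=> nVz; split=> //; have [|/nVz] := DUV z Dz.
  apply/seteqP; split=> // q Qq; have Zq : Z q by rewrite ZPQ; right.
  have [_ Uq] := (ZE q).1 Zq _ clDU (conj Dx (PU _ Px)).
  by rewrite -UV0; split=> //; exact: QV.
have connZ : connected Z.
  move=> B [b Bb] [C oC BC] [C' cC' BC'].
  have cB : closed B by rewrite BC'; exact: closedI.
  have cB' : closed (Z `&` ~` C) by apply: closedI => //; exact: open_closedC.
  have ZB : Z = B `|` (Z `&` ~` C).
    by rewrite BC -setIUr setUv setIT.
  have B0 : B `&` (Z `&` ~` C) = set0.
    by rewrite BC setIACA setICr setI0.
  have [Bx|nBx] := pselect (B x).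
    by rewrite [RHS]ZB (split_Z _ _ cB cB' B0 ZB Bx) setU0.
  have B'x : (Z `&` ~` C) x by move: Zx; rewrite {1}ZB => -[].
  have := split_Z _ _ cB' cB; rewrite setIC setUC => /(_ B0 ZB B'x) E.
  by move: Bb; rewrite E.
have : ~ Z y.
  move=> Zy; apply: nxy; have : connected_component [set: T] x y.
    by exists Z.
  by rewrite tdT.
move=> /ZE /existsNP[D /not_implyP[clD /not_implyP[Dx nDy]]].
by exists D.
Qed.

Lemma continuous_closed_image (T K : topologicalType) (f : T -> K) (C : set T) :
  compact [set: T] -> hausdorff_space K -> continuous f -> closed C ->
  closed (f @` C).
Proof.
move=> cT hK cf cC; apply: compact_closed => //; apply: continuous_compact.
  exact: continuous_subspaceT.
exact: subclosed_compact cC cT _.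
Qed.

Lemma dense_continuous_eq (T K : topologicalType) (A : set T) (f h : T -> K) :
  hausdorff_space K -> dense A -> continuous f -> continuous h ->
  (forall x, A x -> f x = h x) -> f = h.
Proof.
move=> hK dA cf ch fh; apply/funext => x; apply: hK => U V xU xV.
have nUV : nbhs x (f @^-1` U `&` h @^-1` V).
  by apply: filterI; [exact: cf|exact: ch].
have [y [/interior_subset[Uy Vy] Ay]] :=
  dA _ (ex_intro _ x nUV) (@open_interior _ _).
by exists (f y); split => //=; rewrite fh.
Qed.

Lemma ultra_cvg_exists (T : Type) (K : topologicalType) (F : set_system T)
    (m : T -> K) :
  UltraFilter F -> compact [set: K] -> exists l : K, m @ F --> l.
Proof.
move=> UF cK; have PF : ProperFilter F by exact: ultra_proper.
have [l [_ cll]] := cK _ (fmap_proper_filter m PF) filterT.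
exists l => U lU; have [//|FnU] := in_ultra_setVsetC (m @^-1` U) UF.
by have [x [nUx Ux]] := cll (~` U) U FnU lU.
Qed.

(** * Images of profinite groups *)

Section ProfiniteImage.
Variable Q : preTopologicalGroupType.
Hypothesis pfQ : profinite_group Q.

(** The left stabiliser of a clopen neighbourhood V of 1 is a subgroup contained
    in V, and it is clopen because, V being compact and open, the translates
    of V by nearby elements coincide. *)
Lemma profinite_clopen_subgroup (U : set Q) : nbhs 1 U ->
  exists O : set Q, [/\ clopen O, O 1, forall x y, O x -> O y -> O (x * y)
    & O `<=` U].
Proof.
have [mulc _ cQ hQ tdQ] := pfQ => nU.
have zdQ := totally_disconnected_zero_dimensional cQ hQ tdQ.
have [V [V1 [oV cV]] VU] := zero_dimensional_cvg hQ zdQ cQ nU.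
have near_mul x : \forall y \near x, forall v, V (y * v) <-> V (x * v).
  have /compact_near_coveringP cpt := cQ.
  have : \forall y \near x, [set: Q] `<=` (fun v => V (y * v) <-> V (x * v)).
    apply: cpt => v _.
    have mul_near (W : set Q) : open W -> W (x * v) ->
        \forall w \near v & y \near x, W (y * w) /\ W (x * w).
      move=> oW Wxv.
      have [[/= A B] [xA vB] AB] := mulc (x, v) _ (open_nbhs_nbhs (conj oW Wxv)).
      exists (B, A) => // -[w y] /= [Bw Ay]; split; first exact: (AB (y, w)).
      by apply: (AB (x, w)); split => //; exact: nbhs_singleton.
    have [Vxv|nVxv] := pselect (V (x * v)).
      by apply: filterS (mul_near _ oV Vxv) => -[w y] /= [].
    have oVC : open (~` V) by exact: closed_openC.
    by apply: filterS (mul_near _ oVC nVxv) => -[w y] /= [].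
  by apply: filterS => y yV v; exact: yV.
pose O := [set x : Q | forall v, V (x * v) <-> V v].
have near_O x : \forall y \near x, O y <-> O x.
  apply: filterS (near_mul x) => y xy.
  by split=> Ov v; have := Ov v; have := xy v; tauto.
exists O; split.
- split.
    rewrite openE => x Ox; rewrite /interior.
    by apply: filterS (near_O x) => y [_]; exact.
  by move=> x clx; have [y [Oy [+ _]]] := clx _ (near_O x); exact.
- by move=> v; rewrite mul1g.
- by move=> x y Ox Oy v; rewrite -mulgA; have := Ox (y * v); have := Oy v; tauto.
- by move=> x Ox; apply: VU; have := Ox 1; rewrite mulg1; tauto.
Qed.

(** The image S of a clopen subgroup O is closed by compactness. Its preimage is a
    union of cosets of O, hence open, so that the complement of S, as the image
    of a closed set, is closed as well. The translates of these clopen subgroups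
    of K separate points. *)
Lemma profinite_image (K : topologicalGroupType) (phi : Q -> K) :
  hausdorff_space K -> continuous phi -> {morph phi : x y / x * y} ->
  (forall k, exists x, phi x = k) -> profinite_group K.
Proof.
move=> hK cphi phiM phi_surj; have [mulc _ cQ hQ _] := pfQ.
have phi1 : phi 1 = 1.
  by apply: (mulgI (phi 1)); rewrite -phiM !mulg1.
have mull_cont (T : preTopologicalGroupType) (x : T) :
    continuous (fun xy : T * T => xy.1 * xy.2) -> continuous (fun y : T => x * y).
  move=> mc y; apply: (@continuous_comp _ _ _ (fun z : T => (x, z))
    (fun xy : T * T => xy.1 * xy.2)); last exact: mc.
  by apply: cvg_pair; [exact: cvg_cst|exact: cvg_id].
split; [exact: mulg_continuous|exact: invg_continuous| |by []|].
  have <- : phi @` setT = setT.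
    by apply/seteqP; split=> // k _; have [x <-] := phi_surj k; exists x.
  by apply: continuous_compact cQ; exact: continuous_subspaceT.
apply: zero_dimension_totally_disconnected => x y /eqP nxy.
have nU : nbhs 1 (phi @^-1` (~` [set x^-1 * y])).
  apply: cphi; apply: open_nbhs_nbhs; split.
    by apply: closed_openC; exact: accessible_closed_set1 (hausdorff_accessible hK) _.
  rewrite phi1 /= => E; apply: nxy; rewrite -[x]mulg1 E mulgA mulgV mul1g //.
have [O [[oO cO] O1 OM OU]] := profinite_clopen_subgroup nU.
have cS : closed (phi @` O) by exact: continuous_closed_image.
have oP : open (phi @^-1` (phi @` O)).
  rewrite openE => z [o Oo oz]; rewrite /interior.
  have : \forall w \near z, O (z^-1 * w).
    apply: (mull_cont _ z^-1 mulc z); rewrite mulVg.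
    exact: open_nbhs_nbhs.
  apply: filterS => w Ow; exists (o * (z^-1 * w)); first exact: OM.
  by rewrite phiM oz -phiM mulgA mulgV mul1g.
have oS : open (phi @` O).
  rewrite -[phi @` O]setCK; apply: closed_openC.
  suff -> : ~` (phi @` O) = phi @` (~` (phi @^-1` (phi @` O))).
    by apply: continuous_closed_image => //; exact: open_closedC.
  apply/seteqP; split=> [k nk|_ [z nz <-]] //.
  by have [z zk] := phi_surj k; exists z => //=; rewrite zk.
have cx : continuous (fun k : K => x^-1 * k).
  by apply: mull_cont; exact: mulg_continuous.
exists ((fun k : K => x^-1 * k) @^-1` (phi @` O)); split.
- by split; [move/continuousP: cx|move/continuous_closedP: cx]; apply.
- by exists 1 => //; rewrite phi1 mulVg.
- by move=> [o Oo E]; have := OU _ Oo; rewrite /= E.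
Qed.

End ProfiniteImage.

(** * Limits along ultrafilters on the acting group *)

Lemma orbit_ultra (G : topologicalGroupType) (Y : flowType G) (y0 y : Y) :
  closure (act_orbit y0) y ->
  exists F : set_system G, UltraFilter F /\ act g y0 @[g --> F] --> y.
Proof.
move=> cly; pose F0 := filter_from (nbhs y) (fun W => [set g | W (act g y0)]).
have PF0 : ProperFilter F0.
  apply: filter_from_proper.
    apply: filter_from_filter; first by exists setT; exact: filterT.
    by move=> U V yU yV; exists (U `&` V); first exact: filterI.
  by move=> W /cly[_ [[g _ <-] Wg]]; exists g.
have [F [UF F0F]] := ultraFilterLemma PF0.
by exists F; split=> // W yW; apply: F0F; exists W.
Qed.

Lemma dense_closure (T : topologicalType) (A : set T) (x : T) :
  dense A -> closure A x.
Proof.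
move=> dA W nW; have [y [/interior_subset Wy Ay]] :=
  dA _ (ex_intro _ x nW) (@open_interior _ _).
by exists y.
Qed.

(** * Existence of the Bohr compactification below an ambit *)

Section BohrExistence.
Variables (G : topologicalGroupType) (Y : flowType G) (y0 : Y).

(** The equivariant maps of compactifications, with values in arbitrary Hausdorff
    groups: the compactness of the quotient of Y constructed below comes from
    Y. *)
Definition ambit_map (L : topologicalGroupType) (h : G -> L) (f : Y -> L) :
    Prop :=
  [/\ hausdorff_space L, continuous f, f y0 = 1
    & forall g y, f (act g y) = h g * f y].

Lemma compactification_ambit_map (L : topologicalGroupType) (h : G -> L) :
  compactification_below y0 h ->
  exists2 f, ambit_map h f & forall g, h g = f (act g y0).
Proof. by move=> [_ hL _ _ [f [? _ ? ? ?]]]; exists f. Qed.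

Definition bohr_rel (y z : Y) : bool :=
  `[< forall (L : topologicalGroupType) (h : G -> L) f,
      ambit_map h f -> f y = f z >].

Lemma bohr_rel_equiv : equiv_class_of bohr_rel.
Proof.
split=> [y|y z|z y w].
- exact/asboolP.
- by apply/asboolP/asboolP => yz L h f /yz.
- move=> /asboolP yz /asboolP zw; apply/asboolP => L h f hf.
  by rewrite (yz _ _ _ hf) (zw _ _ _ hf).
Qed.

Canonical bohr_equiv := EquivRelPack bohr_rel_equiv.

(** The group law exists because the orbit of y0 is dense, so the carrier takes
    the proof of density as an argument. *)
Definition bohr_group (y0_ambit : ambit y0) : Type :=
  quotient_topology {eq_quot bohr_equiv}%qT.

Hypothesis y0_ambit : ambit y0.

Local Notation K := (bohr_group y0_ambit).

Lemma ambit_ultra (y : Y) :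
  exists F : set_system G, UltraFilter F /\ act g y0 @[g --> F] --> y.
Proof. by apply: orbit_ultra; exact: dense_closure. Qed.

(** If g y0 tends to y along F, the limit w of g z satisfies
    f w = lim (h g * f z) = f y * f z for all f at once. *)
Lemma bohr_mul_exists (y z : Y) :
  exists w, forall (L : topologicalGroupType) (h : G -> L) f,
    ambit_map h f -> f w = f y * f z.
Proof.
have [F [UF Fy]] := ambit_ultra y; have PF := ultra_proper.
have [w Fw] := ultra_cvg_exists (fun g => act g z) UF (@flow_compact G Y).
exists w => L h f [hL cf f1 fM].
apply: (cvg_unique hL (F := f (act g z) @[g --> F])).
  exact: (cvg_comp _ _ Fw (cf w)).
have -> : (fun g => f (act g z)) = (fun g => f (act g y0) * f z).
  by apply/funext => g; rewrite !fM f1 mulg1.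
apply: (cvg_comp (fun g => (f (act g y0), f z))
  (fun kl : L * L => kl.1 * kl.2) _ (@mulg_continuous L (f y, f z))).
by apply: cvg_pair; [exact: (cvg_comp _ _ Fy (cf y))|exact: cvg_cst].
Qed.

(** If g y0 tends to y along F, the limit of g^-1 y0 is an inverse of y modulo
    all f at once. *)
Lemma bohr_inv_exists (y : Y) :
  exists w, forall (L : topologicalGroupType) (h : G -> L) f,
    ambit_map h f -> f w = (f y)^-1.
Proof.
have [F [UF Fy]] := ambit_ultra y; have PF := ultra_proper.
have [w Fw] := ultra_cvg_exists (fun g => act g^-1 y0) UF (@flow_compact G Y).
exists w => L h f [hL cf f1 fM].
apply: (cvg_unique hL (F := f (act g^-1 y0) @[g --> F])).
  exact: (cvg_comp _ _ Fw (cf w)).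
have -> : (fun g => f (act g^-1 y0)) = (fun g => (f (act g y0))^-1).
  apply/funext => g; apply: (mulgI (f (act g y0))).
  by rewrite mulgV fM f1 mulg1 -fM actVK.
exact: (cvg_comp _ _ (cvg_comp _ _ Fy (cf y)) (@invg_continuous L (f y))).
Qed.

HB.instance Definition _ := Topological.on K.

Definition bohr_pi (y : Y) : K :=
  (\pi_(quotient_topology {eq_quot bohr_equiv}) y)%qT.

Definition bohr_repr (k : K) : Y :=
  repr (k : quotient_topology {eq_quot bohr_equiv}%qT).

Lemma bohr_pi_repr (k : K) : bohr_pi (bohr_repr k) = k.
Proof. exact: reprK. Qed.

Lemma bohr_pi_continuous : continuous bohr_pi.
Proof. exact: pi_continuous. Qed.

Lemma bohr_pi_eq (y z : Y) :
  (forall (L : topologicalGroupType) (h : G -> L) f,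
     ambit_map h f -> f y = f z) -> bohr_pi y = bohr_pi z.
Proof. by move=> yz; apply/eqmodP/asboolP. Qed.

Lemma bohr_repr_pi (L : topologicalGroupType) (h : G -> L) f (y : Y) :
  ambit_map h f -> f (bohr_repr (bohr_pi y)) = f y.
Proof.
move=> hf; have /eqmodP/asboolP yz : bohr_pi (bohr_repr (bohr_pi y)) = bohr_pi y.
  exact: bohr_pi_repr.
exact: yz hf.
Qed.

Lemma bohr_separated (p q : K) :
  (forall (L : topologicalGroupType) (h : G -> L) f, ambit_map h f ->
     f (bohr_repr p) = f (bohr_repr q)) -> p = q.
Proof.
by move=> pq; rewrite -[p]bohr_pi_repr -[q]bohr_pi_repr; exact: bohr_pi_eq.
Qed.

Lemma bohr_lift_continuous (L : topologicalGroupType) (h : G -> L) f :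
  ambit_map h f -> continuous (f \o bohr_repr).
Proof.
move=> hf; have [_ cf _ _] := hf.
apply/quotient_continuous.
suff -> : (f \o bohr_repr) \o bohr_pi = f by [].
by apply/funext => y; exact: bohr_repr_pi hf.
Qed.

Definition bohr_mul (p q : K) : K :=
  bohr_pi (projT1 (cid (bohr_mul_exists (bohr_repr p) (bohr_repr q)))).

Definition bohr_inv (p : K) : K :=
  bohr_pi (projT1 (cid (bohr_inv_exists (bohr_repr p)))).

Definition bohr_one : K := bohr_pi y0.

Section Lift.
Variables (L : topologicalGroupType) (h : G -> L) (f : Y -> L).
Hypothesis hf : ambit_map h f.

(** Each f induces a homomorphism on the quotient. These homomorphisms separate
    points by construction, which yields the group axioms below. *)
Lemma bohr_lift_mul p q :
  f (bohr_repr (bohr_mul p q)) = f (bohr_repr p) * f (bohr_repr q).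
Proof.
by rewrite (bohr_repr_pi _ hf); case: cid => w /= /(_ _ _ _ hf).
Qed.

Lemma bohr_lift_inv p : f (bohr_repr (bohr_inv p)) = (f (bohr_repr p))^-1.
Proof.
by rewrite (bohr_repr_pi _ hf); case: cid => w /= /(_ _ _ _ hf).
Qed.

Lemma bohr_lift_one : f (bohr_repr bohr_one) = 1.
Proof. by rewrite (bohr_repr_pi _ hf); have [_ _ -> _] := hf. Qed.

End Lift.

Lemma bohr_mulA : associative bohr_mul.
Proof.
by move=> p q r; apply: bohr_separated => L h f hf; rewrite !(bohr_lift_mul hf) mulgA.
Qed.

Lemma bohr_mul1 : left_id bohr_one bohr_mul.
Proof.
move=> p; apply: bohr_separated => L h f hf.
by rewrite (bohr_lift_mul hf) (bohr_lift_one hf) mul1g.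
Qed.

Lemma bohr_1mul : right_id bohr_one bohr_mul.
Proof.
move=> p; apply: bohr_separated => L h f hf.
by rewrite (bohr_lift_mul hf) (bohr_lift_one hf) mulg1.
Qed.

Lemma bohr_mulV : left_inverse bohr_one bohr_inv bohr_mul.
Proof.
move=> p; apply: bohr_separated => L h f hf.
by rewrite (bohr_lift_mul hf) (bohr_lift_inv hf) (bohr_lift_one hf) mulVg.
Qed.

Lemma bohr_Vmul : right_inverse bohr_one bohr_inv bohr_mul.
Proof.
move=> p; apply: bohr_separated => L h f hf.
by rewrite (bohr_lift_mul hf) (bohr_lift_inv hf) (bohr_lift_one hf) mulgV.
Qed.

HB.instance Definition _ := isGroup.Build K bohr_mulA bohr_mul1
  bohr_1mul bohr_mulV bohr_Vmul.

Lemma bohr_compact : compact [set: K].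
Proof.
have <- : bohr_pi @` setT = setT.
  by apply/seteqP; split=> // k _; exists (bohr_repr k) => //; exact: bohr_pi_repr.
apply: continuous_compact; last exact: flow_compact.
by apply: continuous_subspaceT; exact: bohr_pi_continuous.
Qed.

Lemma bohr_hausdorff : hausdorff_space K.
Proof.
move=> p q clpq; apply: bohr_separated => L h f hf; have [hL _ _ _] := hf.
apply: hL => U V pU qV.
have [r [Ur Vr]] := clpq _ _ (bohr_lift_continuous hf pU)
  (bohr_lift_continuous hf qV).
by exists (f (bohr_repr r)).
Qed.

Lemma bohr_mul_continuous :
  continuous (fun pq : K * K => pq.1 * pq.2).
Proof.
apply: separated_continuous; first exact: bohr_compact.
move=> p q pq; apply: bohr_separated => L h f hf; have [hL _ _ _] := hf.
apply: (pq L (f \o bohr_repr)) => //; first exact: bohr_lift_continuous hf.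
have -> : (f \o bohr_repr) \o (fun pq : K * K => pq.1 * pq.2) =
    (fun kl : L * L => kl.1 * kl.2) \o
    (fun pq => ((f \o bohr_repr) pq.1, (f \o bohr_repr) pq.2)).
  by apply/funext => -[a b] /=; exact: bohr_lift_mul hf _ _.
move=> [a b]; apply: continuous_comp; last exact: mulg_continuous.
apply: cvg_pair.
- apply: (@continuous_comp _ _ _ fst (f \o bohr_repr)); first exact: cvg_fst.
  exact: bohr_lift_continuous hf a.
- apply: (@continuous_comp _ _ _ snd (f \o bohr_repr)); first exact: cvg_snd.
  exact: bohr_lift_continuous hf b.
Qed.

Lemma bohr_inv_continuous : continuous (fun p : K => p^-1).
Proof.
apply: separated_continuous; first exact: bohr_compact.
move=> p q pq; apply: bohr_separated => L h f hf; have [hL _ _ _] := hf.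
apply: (pq L (f \o bohr_repr)) => //; first exact: bohr_lift_continuous hf.
have -> : (f \o bohr_repr) \o (fun p : K => p^-1) =
    (fun k : L => k^-1) \o (f \o bohr_repr).
  by apply/funext => a /=; exact: bohr_lift_inv hf _.
move=> a; apply: continuous_comp; last exact: invg_continuous.
exact: bohr_lift_continuous hf a.
Qed.

HB.instance Definition _ := PreTopologicalGroup_isTopologicalGroup.Build
  K bohr_mul_continuous bohr_inv_continuous.

Lemma bohr_group_below :
  bohr_below y0 (fun g => bohr_pi (act g y0) : K).
Proof.
have piM g y : bohr_pi (act g y) = bohr_pi (act g y0) * bohr_pi y.
  apply: bohr_separated => L h f hf; rewrite (bohr_lift_mul hf).
  by rewrite !(bohr_repr_pi _ hf); have [_ _ f1 fM] := hf; rewrite !fM f1 mulg1.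
have dense_pi : dense (range (fun g => bohr_pi (act g y0) : K)).
  move=> O [k Ok] oO; have oP : open (bohr_pi @^-1` O).
    by move/continuousP: bohr_pi_continuous; apply.
  have [|y [Oy [g _ gy]]] := y0_ambit _ oP.
    by exists (bohr_repr k); rewrite /= bohr_pi_repr.
  by exists (bohr_pi y); split=> //; exists g => //; rewrite gy.
split.
  split; [exact: bohr_compact|exact: bohr_hausdorff| |exact: dense_pi|].
    by move=> a b /=; rewrite actM piM.
  exists bohr_pi; split => //; first exact: bohr_pi_continuous.
  by move=> k; exists (bohr_repr k); exact: bohr_pi_repr.
move=> L h ch; have [f hf hE] := compactification_ambit_map ch.
have [hL _ _ _] := hf.
exists (f \o bohr_repr); split.
  split; first exact: bohr_lift_continuous hf.
    exact: bohr_lift_mul hf.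
  by apply/funext => g /=; rewrite (bohr_repr_pi _ hf).
move=> phi [cphi _ phiE]; apply: (dense_continuous_eq hL dense_pi) => //.
  exact: bohr_lift_continuous hf.
move=> _ [g _ <-] /=; rewrite (bohr_repr_pi _ hf) -hE.
by rewrite phiE.
Qed.

End BohrExistence.

(** * Compactifications of the Ellis semigroup and the Ellis group *)

Lemma ellis_ambit (G : topologicalGroupType) (X : flowType G) :
  ambit (1 : ellis X).
Proof.
move=> O [a Oa] oO; have [g Og] := ellis_dense (open_nbhs_nbhs (conj oO Oa)).
by exists (act g (1 : ellis X)); split=> //; exists g.
Qed.

Section EllisToGroup.
Variables (G : topologicalGroupType) (X : flowType G).
Variables (K : topologicalGroupType) (h : G -> K) (f : ellis X -> K).
Hypothesis hf : ambit_map (1 : ellis X) h f.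

(** For a = act g 1 the identity is the equivariance of f; both sides are
    continuous in a, as right multiplications are. *)
Lemma ambit_map_morph : {morph f : a b / a * b}.
Proof.
have [hK cf f1 fM] := hf; move=> a b.
have [F [UF Fa]] := ambit_ultra (@ellis_ambit G X) a.
have PF := ultra_proper.
have fgb : f (act g b) @[g --> F] --> f (a * b).
  have -> : (fun g => f (act g b)) = (fun g => f (act g (1 : ellis X) * b)).
    by apply/funext => g; rewrite -ellis_actE.
  have ab := cvg_comp _ _ Fa (@ellis_mulr_continuous _ _ b a).
  exact: (cvg_comp _ _ ab (cf _)).
apply: (cvg_unique hK fgb).
have -> : (fun g => f (act g b)) = (fun g => f (act g (1 : ellis X)) * f b).
  by apply/funext => g; rewrite !fM f1 mulg1.
apply: (cvg_comp (fun g => (f (act g (1 : ellis X)), f b))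
  (fun kl : K * K => kl.1 * kl.2) _ (@mulg_continuous K (f a, f b))).
by apply: cvg_pair; [exact: (cvg_comp _ _ Fa (cf a))|exact: cvg_cst].
Qed.

Lemma ambit_map_idempotent (u : ellis X) : u * u = u -> f u = 1.
Proof.
by move=> uu; apply: (mulgI (f u)); rewrite -ambit_map_morph uu mulg1.
Qed.

Variables (M : set (ellis X)) (u : ellis X).
Hypotheses (minM : minimal_left_ideal M) (Mu : M u) (uu : u * u = u).

Local Notation T := (ellis_group minM Mu uu).

(** If g_i tends to u and g_i b_i to p, then
    f b_i = (h g_i)^-1 * f (g_i b_i) tends to (f u)^-1 * f p = f p. *)
Lemma ambit_map_tau_continuous : continuous (fun p : T => f (val p)).
Proof.
have [hK cf f1 fM] := hf.
apply/continuous_closedP => C cC; rewrite /closed /= closure_tau.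
move=> p /circP clp; apply: contrapT => nCp.
have divc : continuous (fun kl : K * K => kl.1^-1 * kl.2).
  move=> [k l]; apply: (@continuous_comp _ _ _
    (fun kl : K * K => (kl.1^-1, kl.2)) (fun kl : K * K => kl.1 * kl.2)).
    apply: cvg_pair; last exact: cvg_snd.
    apply: (@continuous_comp _ _ _ fst (fun k : K => k^-1)).
      exact: cvg_fst.
    exact: invg_continuous.
  exact: mulg_continuous.
have nC : nbhs ((f u)^-1 * f (val p)) (~` C).
  rewrite (ambit_map_idempotent uu) invg1 mul1g; apply: open_nbhs_nbhs.
  by split=> //; exact: closed_openC.
have [[/= W V] [nW nV] WV] := divc (f u, f (val p)) _ nC.
have [g [_ [[b Cb <-] /= Wg Vgb]]] := clp _ _ (cf _ _ nW) (cf _ _ nV).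
apply: (WV (f (act g (1 : ellis X)), f (act g (val b)))) => //=.
by rewrite !fM f1 mulg1 mulgA mulVg mul1g.
Qed.

(** An element a of the Ellis semigroup and u a u have the same image, as f u is
    1. *)
Lemma ambit_map_group_surj :
  (forall k, exists a, f a = k) -> forall k, exists p : T, f (val p) = k.
Proof.
move=> f_surj k; have [a ak] := f_surj k.
have uau : u * (a * u) \in [set u * m | m in M].
  by apply/mem_set; exists (a * u) => //; have [[_ idM] _] := minM; exact: idM.
exists (exist _ (u * (a * u)) uau : T).
by rewrite /= !ambit_map_morph (ambit_map_idempotent uu) mul1g mulg1.
Qed.

(** f p lies in the closure of every neighbourhood of 1 in the Hausdorff group
    K. *)
Lemma ambit_map_H (p : T) : ellis_group_H minM Mu uu p -> f (val p) = 1.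
Proof.
have [hK _ _ _] := hf => Hp.
apply/esym/hK => A B /nbhs_interior A1 pB.
have cft := ambit_map_tau_continuous.
have := Hp ((fun p : T => f (val p)) @^-1` A°); rewrite /= -closure_tau.
move=> /(_ _ _ (cft p _ pB))[|q [/interior_subset Aq Bq]]; last first.
  by exists (f (val q)).
split; first by move/continuousP: cft; apply; exact: open_interior.
by rewrite /= (ambit_map_idempotent uu); exact: nbhs_singleton.
Qed.

End EllisToGroup.

Section Descent.
Variables (G : topologicalGroupType) (X : flowType G).

Lemma profinite_quotient_bohr (M : set (ellis X)) (u : ellis X)
    (minM : minimal_left_ideal M) (Mu : M u) (uu : u * u = u) :
  profinite_quotient (ellis_group_H minM Mu uu) ->
  profinite_bohr_below (1 : ellis X).
Proof.
move=> [Q [pi [[pi_surj piM piH pi_open] pfQ]]].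
exists (bohr_group (@ellis_ambit G X)),
  (fun g => bohr_pi (@ellis_ambit G X) (act g (1 : ellis X))).
have bohrK := bohr_group_below (@ellis_ambit G X); split=> //.
have [[_ hK _ _ [f [cf f_surj f1 fM _]]] _] := bohrK.
have hf := And4 hK cf f1 fM.
pose T := ellis_group minM Mu uu.
pose phi (q : Q) := f (val (projT1 (cid (pi_surj q)) : T)).
have phi_pi (p : T) : phi (pi p) = f (val p).
  rewrite /phi; case: cid => p' /= p'p.
  have Hp : f (val (p^-1 * p')) = 1.
    apply: (ambit_map_H hf) ; apply/piH; apply: (mulgI (pi p)).
    by rewrite -piM mulgA mulgV mul1g mulg1.
  apply/esym/(mulIg (f (val p))^-1); rewrite mulgV.
  have fT : f (val p) * f (val (p^-1 * p')) = f (val p').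
    rewrite -(ambit_map_morph hf) -[_ * val _]/(val (p * (p^-1 * p'))).
    by rewrite mulgA mulgV mul1g.
  by rewrite -fT Hp mulg1 mulgV.
apply: (profinite_image pfQ (phi := phi)) => //.
- apply/continuousP => V oV; apply/pi_open.
  have -> : pi @^-1` (phi @^-1` V) = (fun p : T => f (val p)) @^-1` V.
    by apply/funext => p /=; rewrite phi_pi.
  have cft : continuous (fun p : T => f (val p)) := 
    @ambit_map_tau_continuous _ _ _ _ _ hf M u minM Mu uu.
  by move/continuousP: cft; apply.
- move=> q q'; have [p <-] := pi_surj q; have [p' <-] := pi_surj q'.
  by rewrite -piM !phi_pi -(ambit_map_morph hf).
- move=> k; have [p <-] : exists p : T, f (val p) = k := 
    ambit_map_group_surj hf minM Mu uu f_surj k.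
  by exists (pi p).
Qed.

Lemma ellis_eval_continuous (x : X) : continuous (fun a : ellis X => ellis_fun a x).
Proof.
move=> a; apply: (@continuous_comp _ _ _ (val : ellis X -> _)
  (fun k : prod_topology (fun _ : X => X) => k x)).
  exact: val_subflow_continuous.
exact: prod_eval_continuous.
Qed.

Lemma ellis_eval_surj (x0 x : X) :
  ambit x0 -> exists a : ellis X, ellis_fun a x0 = x.
Proof.
move=> x0_ambit; have [F [UF Fx]] := ambit_ultra x0_ambit x.
have PF := ultra_proper.
have [a Fa] := ultra_cvg_exists (fun g => act g (1 : ellis X)) UF
  (@flow_compact G (ellis X)).
exists a; apply: (cvg_unique (@flow_hausdorff G X) _ Fx).
exact: (cvg_comp _ _ Fa (@ellis_eval_continuous x0 a)).
Qed.

Lemma compactification_below_ellis (x0 : X) (K : topologicalGroupType)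
    (h : G -> K) :
  ambit x0 -> compactification_below x0 h ->
  compactification_below (1 : ellis X) h.
Proof.
move=> x0_ambit [cK hK hM dh [f [cf f_surj f1 fM hE]]]; split=> //.
exists (fun a => f (ellis_fun a x0)); split=> //.
- move=> a; apply: (@continuous_comp _ _ _ (fun a => ellis_fun a x0) f).
    exact: ellis_eval_continuous.
  exact: cf.
- move=> k; have [x <-] := f_surj k.
  by have [a <-] := ellis_eval_surj x x0_ambit; exists a.
- by move=> g a; rewrite -fM.
Qed.

(** The universal property of the Bohr compactification K below (E(X), id),
    applied to the one below (X, x0), gives a homomorphism with dense and
    compact image. *)
Lemma profinite_bohr_descends (x0 : X) : ambit x0 ->
  profinite_bohr_below (1 : ellis X) -> profinite_bohr_below x0.
Proof.
move=> x0_ambit [K [b [[[cK _ _ _ _] univ] pfK]]].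
have bohrL := bohr_group_below x0_ambit.
exists (bohr_group x0_ambit), (fun g => bohr_pi x0_ambit (act g x0)).
split=> //; have [compL _] := bohrL; have [_ hL _ dL _] := compL.
have [phi [[cphi phiM phib] _]] :=
  univ _ _ (compactification_below_ellis x0_ambit compL).
apply: (profinite_image pfK (phi := phi)) => //.
move=> k; have clphi : closed (range phi).
  by apply: continuous_closed_image => //; exact: closedT.
have [y _ <-] : range phi k; last by exists y.
apply: clphi => W /(@dense_closure _ _ k dL _)[_ [[g _ <-] Wg]].
exists (phi (b g)); split; first by exists (b g).
by rewrite -[phi (b g)]/((phi \o b) g) -phib.
Qed.

(** In a Hausdorff topology the closures of the neighbourhoods of 1 intersect in
    1 only, so H(uM) is trivial and uM is its own quotient. *)
Lemma profinite_ellis_group_quotient (M : set (ellis X)) (u : ellis X)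
    (minM : minimal_left_ideal M) (Mu : M u) (uu : u * u = u) :
  profinite_group (ellis_group minM Mu uu) ->
  profinite_quotient (ellis_group_H minM Mu uu).
Proof.
move=> pf; exists (ellis_group minM Mu uu), id; split=> //.
have [_ _ _ hT _] := pf; split=> //; first by move=> y; exists y.
move=> p; split=> [->|Hp]; first by move=> U [_ U1]; exact: subset_cl_tau.
apply/esym/hT => U V /nbhs_interior U1 pV.
have := Hp U°; rewrite /= -closure_tau => /(_ _ V pV)[|q [/interior_subset Uq Vq]].
  by split; [exact: open_interior|exact: nbhs_singleton].
by exists q.
Qed.

End Descent.

(** * Ellis groups and homomorphisms of Ellis semigroups *)

Section FiniteEllisGroup.
Variable G : topologicalGroupType.

(** For n in N with n u = u, the map p |-> v p n from uM to vN has the left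
    inverse q |-> a q u, where a v u = u. *)
Lemma finite_ellis_group_any (X : flowType G) (M : set (ellis X)) (u : ellis X)
    (minM : minimal_left_ideal M) (Mu : M u) (uu : u * u = u) :
  finite_ellis_group X -> finite_set [set: ellis_group minM Mu uu].
Proof.
move=> [N [v [minN [Nv [vv finN]]]]].
have [[_ idM] minM'] := minM; have [[_ idN] _] := minN.
have [n Nn nu] : exists2 n, N n & n * u = u.
  suff E : [set n * u | n in N] = M by move: (Mu); rewrite -{1}E.
  apply: minM' => [|_ [n Nn <-]]; last exact: idM.
  split; first by exists (v * u); exists v.
  by move=> a _ [n Nn <-]; exists (a * n); [exact: idN|rewrite mulgA].
have [a _ avu] : exists2 a, M a & a * (v * u) = u.
  exact: (minimal_ideal_solve minM Mu (idM v u Mu) Mu).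
have vN (p : ellis_group minM Mu uu) : v * (val p * n) \in [set v * m | m in N].
  by apply/mem_set; exists (val p * n) => //; exact: idN.
pose F p : ellis_group minN Nv vv := exist _ (v * (val p * n)) (vN p).
have FE p : a * (val (F p) * u) = val p.
  rewrite /= -!mulgA nu -[in LHS](ellis_group_mull p) !mulgA -[a * v * u]mulgA.
  by rewrite avu -!mulgA ellis_group_mulr ellis_group_mull.
suff injF : {in F @^-1` setT &, injective F} by exact: finite_preimage injF finN.
by move=> p q _ _ E; apply: val_inj; rewrite -FE E FE.
Qed.

Section Image.
Variables (Z Y : flowType G) (theta : ellis Z -> ellis Y).
Hypotheses (thetaM : {morph theta : a b / a * b})
  (theta_surj : forall b, exists a, theta a = b).
Variables (M : set (ellis Z)) (u : ellis Z).
Hypotheses (minM : minimal_left_ideal M) (Mu : M u) (uu : u * u = u).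

(** The part of M that theta sends into a left ideal inside theta M is a left
    ideal, hence all of M. *)
Lemma minimal_left_ideal_image : minimal_left_ideal (theta @` M).
Proof.
have [[_ idM] minM'] := minM; split.
  split; first by exists (theta u); exists u.
  move=> b _ [m Mm <-]; have [a <-] := theta_surj b.
  by exists (a * m); [exact: idM|rewrite thetaM].
move=> N [[n Nn] idN] NM; apply/seteqP; split=> // _ [m Mm <-].
suff E : M `&` theta @^-1` N = M by move: Mm; rewrite -E => -[].
apply: minM' => [|x []//]; split.
  by have [m' Mm' m'n] := NM _ Nn; exists m'; split=> //=; rewrite m'n.
by move=> a x [Mx Nx]; split; [exact: idM|rewrite /= thetaM; exact: idN].
Qed.

Lemma image_ideal_idempotent : (theta @` M) (theta u).
Proof. by exists u. Qed.

Lemma image_idempotent : theta u * theta u = theta u.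
Proof. by rewrite -thetaM uu. Qed.

Local Notation T := (ellis_group minM Mu uu).
Local Notation T' := (ellis_group minimal_left_ideal_image
  image_ideal_idempotent image_idempotent).

Lemma ellis_group_map_subproof (p : T) :
  theta (val p) \in [set theta u * m | m in theta @` M].
Proof.
apply/mem_set; exists (theta (val p)).
  by exists (val p) => //; exact: ellis_group_ideal.
by rewrite -thetaM ellis_group_mull.
Qed.

Definition ellis_group_map (p : T) : T' :=
  exist _ (theta (val p)) (ellis_group_map_subproof p).

Lemma ellis_group_map_morph : {morph ellis_group_map : p q / p * q}.
Proof. by move=> p q; apply: val_inj; rewrite /= thetaM. Qed.

Lemma ellis_group_map_surj (q : T') : exists p, ellis_group_map p = q.
Proof.
have [_ [m Mm <-] mq] := ellis_groupP q.
have um : u * m \in [set u * m | m in M] by apply/mem_set; exists m.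
by exists (exist _ (u * m) um); apply: val_inj; rewrite /= thetaM.
Qed.

(** The homomorphism theta carries nets witnessing membership in u o B to nets
    witnessing membership in theta u o theta B. *)
Lemma ellis_group_map_continuous :
  continuous theta ->
  (forall g, theta (act g (1 : ellis Z)) = act g (1 : ellis Y)) ->
  continuous ellis_group_map.
Proof.
move=> ctheta theta_act; apply/continuous_closedP => C cC.
rewrite /closed /= closure_tau => p /circP clp.
apply: cC; rewrite closure_tau; apply/circP => W V nW nV.
have [g [_ [[b Cb <-] /= Wg Vgb]]] := clp _ _ (ctheta _ _ nW) (ctheta _ _ nV).
exists g, (theta (val b)); split; first by exists (ellis_group_map b).
- by rewrite -theta_act.
- by move: Vgb; rewrite /= ellis_actE thetaM theta_act -ellis_actE.
Qed.

End Image.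

Lemma finite_ellis_group_image (Z Y : flowType G) (theta : ellis Z -> ellis Y) :
  {morph theta : a b / a * b} -> (forall b, exists a, theta a = b) ->
  finite_ellis_group Z -> finite_ellis_group Y.
Proof.
move=> thetaM theta_surj [M [u [minM [Mu [uu finM]]]]].
exists _, _, (minimal_left_ideal_image thetaM theta_surj minM Mu),
  (image_ideal_idempotent theta Mu), (image_idempotent thetaM uu).
have <- : range (ellis_group_map thetaM theta_surj (minM := minM) (Mu := Mu)
    (uu := uu)) = setT.
  apply/seteqP; split=> // q _.
  by have [p <-] := ellis_group_map_surj q; exists p.
exact: finite_image.
Qed.

(** The action of an ultrafilter on flows commutes with equivariant continuous
    maps. *)
Lemma equivariant_limit (W Z : flowType G) (f : W -> Z) (F : set_system G)
    (a : ellis Z) (w w' : W) :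
  ProperFilter F -> continuous f ->
  (forall g w, f (act g w) = act g (f w)) ->
  act g w @[g --> F] --> w' -> act g (1 : ellis Z) @[g --> F] --> a ->
  ellis_fun a (f w) = f w'.
Proof.
move=> PF cf fA Fw' Fa.
have f_lim : f (act g w) @[g --> F] --> f w' := cvg_comp _ _ Fw' (cf w').
apply: (cvg_unique (@flow_hausdorff G Z) _ f_lim).
have -> : (fun g => f (act g w)) =
    (fun g => ellis_fun (act g (1 : ellis Z)) (f w)).
  by apply/funext => g; rewrite fA.
exact: (cvg_comp _ _ Fa (@ellis_eval_continuous _ _ (f w) a)).
Qed.

(** Y is a factor of the subflow f(W) of Z, and W takes the place of this
    subflow. *)
Section Subquotient.
Variables (W Z Y : flowType G) (f : W -> Z) (q : W -> Y).
Hypotheses (cf : continuous f) (cq : continuous q).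
Hypotheses (fA : forall g w, f (act g w) = act g (f w))
  (qA : forall g w, q (act g w) = act g (q w)).
Hypotheses (q_surj : forall y, exists w, q w = y)
  (fq : forall w w', f w = f w' -> q w = q w').

(** The graph of the homomorphism: a and b are limits along the same ultrafilter,
    expressed by their values. *)
Let rel (a : ellis Z) (b : ellis Y) :=
  forall w, exists2 w', f w' = ellis_fun a (f w) & ellis_fun b (q w) = q w'.

Let rel_ultra (F : set_system G) a b : UltraFilter F ->
  act g (1 : ellis Z) @[g --> F] --> a -> act g (1 : ellis Y) @[g --> F] --> b ->
  rel a b.
Proof.
move=> UF Fa Fb w; have PF := ultra_proper.
have [w' Fw'] := ultra_cvg_exists (fun g => act g w) UF (@flow_compact G W).
exists w'; [apply/esym|]; apply: equivariant_limit Fw' _ => //.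
Qed.

Lemma ellis_hom_exists : exists theta : ellis Z -> ellis Y,
  [/\ {morph theta : a b / a * b}, forall b, exists a, theta a = b
    & forall a w w', f w' = ellis_fun a (f w) ->
        ellis_fun (theta a) (q w) = q w'].
Proof.
have total a : exists b, rel a b.
  have [F [UF Fa]] := ambit_ultra (@ellis_ambit G Z) a.
  have [b Fb] := ultra_cvg_exists (fun g => act g (1 : ellis Y)) UF
    (@flow_compact G (ellis Y)).
  by exists b; exact: rel_ultra Fa Fb.
have total' b : exists a, rel a b.
  have [F [UF Fb]] := ambit_ultra (@ellis_ambit G Y) b.
  have [a Fa] := ultra_cvg_exists (fun g => act g (1 : ellis Z)) UF
    (@flow_compact G (ellis Z)).
  by exists a; exact: rel_ultra Fa Fb.
have rel_fun a b : rel a b -> forall w w', f w' = ellis_fun a (f w) ->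
    ellis_fun b (q w) = q w'.
  by move=> ab w w' w'E; have [v vE ->] := ab w; apply: fq; rewrite vE w'E.
have [theta thetaP] := choice total.
have ellis_eq (b b' : ellis Y) :
    (forall w, ellis_fun b (q w) = ellis_fun b' (q w)) -> b = b'.
  move=> bb'; apply: val_inj; apply/funext => y.
  by have [w <-] := q_surj y; exact: bb'.
exists theta; split; last by move=> a; exact: rel_fun (thetaP a).
- move=> a a'; apply: ellis_eq => w.
  have [w1 w1E b1] := thetaP a' w; have [w2 w2E b2] := thetaP a w1.
  transitivity (q w2); last first.
    by rewrite -b2 -b1.
  apply: (rel_fun _ _ (thetaP _)).
  by rewrite w2E w1E.
- move=> b; have [a ab] := total' b; exists a; apply: ellis_eq => w.
  have [w' w'E ->] := ab w.
  exact: (rel_fun _ _ (thetaP a)).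
Qed.

End Subquotient.

Section Factor.
Variables (Z Y : flowType G) (q : Z -> Y).
Hypotheses (cq : continuous q) (qA : forall g z, q (act g z) = act g (q z))
  (q_surj : forall y, exists z, q z = y).

Lemma ellis_factor_exists : exists theta : ellis Z -> ellis Y,
  [/\ {morph theta : a b / a * b}, forall b, exists a, theta a = b,
      continuous theta,
      forall g, theta (act g (1 : ellis Z)) = act g (1 : ellis Y)
    & forall a z, ellis_fun (theta a) (q z) = q (ellis_fun a z)].
Proof.
have cid : continuous (@idfun Z) by move=> z; exact: cvg_id.
have [theta [thetaM theta_surj thetaE]] :=
  @ellis_hom_exists Z Z Y idfun q cid cq (fun _ _ => erefl) qA q_surj
    (fun w w' e => congr1 q e).
have {}thetaE a z : ellis_fun (theta a) (q z) = q (ellis_fun a z).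
  exact: thetaE.
exists theta; split=> //.
  apply: (@continuous_comp_initial _ (ellis Z)
    (prod_topology (fun _ : Y => Y)) set_val).
  move=> a; apply: (prod_cvgP _ (fmap_filter _ (nbhs_filter a))).2 => y.
  have [z <-] := q_surj y.
  have E : (fun b : ellis Z => ellis_fun (theta b) (q z)) =
      q \o (fun b => ellis_fun b z) by apply/funext => b /=; exact: thetaE.
  suff : continuous (fun b : ellis Z => ellis_fun (theta b) (q z)) by exact.
  rewrite E => b; apply: continuous_comp; last exact: cq.
  exact: ellis_eval_continuous.
move=> g; apply: val_inj; apply/funext => y; have [z <-] := q_surj y.
by have := thetaE (act g (1 : ellis Z)) z; rewrite /= qA.
Qed.

End Factor.
End FiniteEllisGroup.

(** * Profinite Ellis groups *)

(** The homomorphisms f to discrete groups are locally constant, so multiplication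
    and inversion are continuous after composition with each f, and their fibres
    are clopen sets that separate points. *)
Lemma residually_discrete_profinite (P : preTopologicalGroupType) :
  compact [set: P] ->
  (forall p q : P, p <> q -> exists (L : preTopologicalGroupType) (f : P -> L),
    [/\ continuous f, {morph f : x y / x * y}, forall U : set L, open U
      & f p <> f q]) ->
  profinite_group P.
Proof.
move=> cP sep.
have fiber (L : preTopologicalGroupType) (f : P -> L) p :
    continuous f -> (forall U : set L, open U) -> nbhs p (f @^-1` [set f p]).
  by move=> cf discL; apply: cf; apply: open_nbhs_nbhs.
have discrete_hausdorff (L : preTopologicalGroupType) :
    (forall U : set L, open U) -> hausdorff_space L.
  move=> discL x y /(_ [set x] [set y])[||z [-> ->]] //;
  exact: open_nbhs_nbhs.
have morphV (L : preTopologicalGroupType) (f : P -> L) x :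
    {morph f : x y / x * y} -> f x^-1 = (f x)^-1.
  move=> fM; have f1 : f 1 = 1 by apply: (mulgI (f 1)); rewrite -fM !mulg1.
  by apply: (mulgI (f x)); rewrite -fM !mulgV.
split=> //.
- apply: separated_continuous => // y z yz.
  apply: contrapT => /sep[L [f [cf fM discL]]].
  apply; apply: yz => //; first exact: discrete_hausdorff.
  move=> [p q] U /nbhs_singleton Upq.
  exists (f @^-1` [set f p], f @^-1` [set f q]); first by split; exact: fiber.
  by move=> [p' q'] /= [p'p q'q]; rewrite /= fM p'p q'q -fM.
- apply: separated_continuous => // y z yz.
  apply: contrapT => /sep[L [f [cf fM discL]]].
  apply; apply: yz => //; first exact: discrete_hausdorff.
  move=> p U /nbhs_singleton Up; apply: filterS (fiber _ f p cf discL) => p' /= p'p.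
  by rewrite morphV // p'p -morphV.
- move=> p q clpq; apply: contrapT => /sep[L [f [cf _ discL]]]; apply.
  have [r [/= <- <-]] // := clpq _ _ (fiber _ f p cf discL) (fiber _ f q cf discL).
- apply: zero_dimension_totally_disconnected => p q /eqP /sep[L [f [cf _ discL npq]]].
  exists (f @^-1` [set f p]); split=> //; last by move=> /= /esym.
  split; first by move/continuousP: cf; apply.
  by move/continuous_closedP: cf; apply; rewrite -openC; exact: discL.
Qed.

Section TauTopology.
Variables (G : topologicalGroupType) (X : flowType G).
Variables (M : set (ellis X)) (u : ellis X).
Hypotheses (minM : minimal_left_ideal M) (Mu : M u) (uu : u * u = u).

Local Notation T := (ellis_group minM Mu uu).

(** A limit of g_i b with g_i tending to u is u b = b. *)
Lemma tau_closed1 (b : T) : closed [set b].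
Proof.
rewrite /closed /= closure_tau => p /circP clp.
apply: val_inj; apply: (@flow_hausdorff G (ellis X)) => V W nV nW.
have nW' : nbhs (u * val b) W by rewrite ellis_group_mull.
have [g [_ [[_ -> <-] Wg Vg]]] := clp _ _ (ellis_mulr_continuous nW') nV.
by exists (act g (val b)); split=> //; rewrite ellis_actE.
Qed.

Lemma tau_finite_discrete : finite_set [set: T] -> forall U : set T, open U.
Proof.
move=> finT U; rewrite -[U]setCK openC.
have acc : accessible_space T.
  move=> x y /eqP xy; exists (~` [set y]); split.
  - by apply: closed_openC; exact: tau_closed1.
  - by rewrite inE.
  - by rewrite inE setCK.
by apply: (accessible_finite_set_closed.1 acc); exact: sub_finite_set finT.
Qed.

(** If an ultrafilter on uM converges to p in E(X), then it tau-converges to u p.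
    Indeed p = p u lies in M, and for every set A of the ultrafilter p is in the
    closure of A, hence u p in u o A. *)
Lemma tau_compact : compact [set: T].
Proof.
rewrite compact_ultra => H UH _; have PH := ultra_proper.
have [p Hp] := ultra_cvg_exists (fun x : T => val x) UH (@flow_compact G (ellis X)).
have pu : p * u = p.
  apply: (cvg_unique (@flow_hausdorff G (ellis X)) _ Hp).
  have -> : (fun x : T => val x) = (fun x : T => val x * u).
    by apply/funext => x; rewrite ellis_group_mulr.
  exact: (cvg_comp _ _ Hp (@ellis_mulr_continuous _ _ u p)).
have upM : u * p \in [set u * m | m in M].
  apply/mem_set; exists p => //; rewrite -pu.
  by have [[_ idM] _] := minM; exact: idM.
exists (exist _ (u * p) upM); split=> //=.
rewrite -[_ --> _]/([set q : T | H --> q] _) -ultra_cvg_clusterE.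
move=> A B HA; suff : closure A (exist _ (u * p) upM : T) by apply.
rewrite closure_tau; apply/circP => W V nW nV.
have [g [Wg]] :=
  ellis_dense (filterI nW (ellis_mulr_continuous (nbhs_interior nV))).
rewrite /= -ellis_actE => Vgp.
have HV : H [set b | V (act g (val b))] by exact: Hp _ (act_cts Vgp).
have [b [Ab Vgb]] := filter_ex (filterI HA HV).
by exists g, (val b); split=> //; exists b.
Qed.

End TauTopology.

(** * Zero-dimensional flows as inverse limits of Stone flows *)

Section StoneFactors.
Variables (G : topologicalGroupType) (X : flowType G).
Hypothesis X_dim0 : zero_dimensional_basis X.

Lemma zero_dimensional_basis_separated : zero_dimensional X.
Proof.
move=> x y /eqP xy; have [B [_ Bx] Bclopen] := X_dim0.
have nU : nbhs x (~` [set y]).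
  apply: open_nbhs_nbhs; split=> //; apply: closed_openC.
  exact: accessible_closed_set1 (hausdorff_accessible (@flow_hausdorff G X)) _.
have [U [BU Ux] Uy] := Bx _ _ nU.
by exists U; split=> //; [exact: Bclopen|move=> /Uy; apply].
Qed.

Lemma stone_point_act (D : set (set (set X))) (clD : D `<=` clopen_orbits X)
    (g : G) (x : X) :
  stone_point clD (act g x) = act g (stone_point clD x).
Proof.
apply: val_inj; apply/seteqP; split=> U.
  move=> [AU Ugx]; apply/mem_stone_act; split=> //.
  have [_ _ _ Ag] := generated_G_algebraP D.
  by rewrite -[g in act g]invgK -mem_translate; exact: Ag.
move=> /mem_stone_act[AU Ux]; split=> //.
have [_ _ _ Ag] := generated_G_algebraP D.
have := Ag g _ AU; rewrite -[g in act g]invgK -mem_translate -translateM.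
by rewrite mulgV translate1.
Qed.

Lemma generated_G_algebra_base (D : set (set (set X))) (U : set X) :
  D (set_orbit U) -> generated_G_algebra D U.
Proof.
move=> DU B [_ sB]; apply: sB; exists (set_orbit U) => //.
by exists 1 => //; exact: translate1.
Qed.

(** If p x and q x are separated by a clopen set U, then p and q already act
    differently on the Stone flow of the single orbit of U. *)
Lemma stone_finite_ellis_profinite (M : set (ellis X)) (u : ellis X)
    (minM : minimal_left_ideal M) (Mu : M u) (uu : u * u = u) :
  (forall (Delta : set (set (set X))) (subDelta : Delta `<=` clopen_orbits X),
     finite_set Delta -> finite_ellis_group (stone subDelta)) ->
  profinite_group (ellis_group minM Mu uu).
Proof.
move=> finC; apply: residually_discrete_profinite; first exact: tau_compact.
move=> p q npq.
have [x pqx] : exists x, ellis_fun (val p) x <> ellis_fun (val q) x.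
  apply: contrapT => /forallNP pq; apply: npq; apply: val_inj; apply: val_inj.
  by apply/funext => x; apply: contrapT; exact: pq.
have [U [clU Up Uq]] := zero_dimensional_basis_separated (introN eqP pqx).
pose D := [set set_orbit U].
have clD : D `<=` clopen_orbits X by move=> _ ->; exists U.
have AU : generated_G_algebra D U by exact: generated_G_algebra_base.
have [theta [thetaM theta_surj ctheta theta_act thetaE]] :=
  ellis_factor_exists (@stone_point_continuous _ _ _ clD) (stone_point_act clD)
    (@stone_point_surj _ _ _ clD).
exists _, (ellis_group_map thetaM theta_surj (minM := minM) (Mu := Mu)
  (uu := uu)); split.
- exact: ellis_group_map_continuous.
- exact: ellis_group_map_morph.
- apply: tau_finite_discrete; apply: finite_ellis_group_any; apply: finC;
  exact: finite_set1.
- move=> E; have := congr1 (fun t => ellis_fun (val t) (stone_point clD x)) E.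
  rewrite /= !thetaE => /(congr1 (fun s => val s U)) /= sE.
  have : generated_G_algebra D U /\ U (ellis_fun (val p) x) by [].
  by rewrite sE => -[_ /Uq].
Qed.

End StoneFactors.

Section StoneSystem.
Variables (G : topologicalGroupType) (X : flowType G).

Lemma generated_G_algebraS (D D' : set (set (set X))) :
  D `<=` D' -> @generated_G_algebra G X D `<=` generated_G_algebra D'.
Proof.
move=> DD'; apply: smallest_sub; first exact: generated_G_algebraP.
move=> U [O DO OU] B [_ sB]; apply: sB; exists O => //; exact: DD'.
Qed.

Section Restriction.
Variables (D D' : set (set (set X))).
Hypotheses (clD : D `<=` @clopen_orbits G X) (clD' : D' `<=` @clopen_orbits G X).
Hypothesis DD' : D `<=` D'.

Lemma stone_restrict_subproof (p : stone clD') :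
  val p `&` generated_G_algebra D \in
    [set p | ultrafilter_on (generated_G_algebra D) p].
Proof.
have [pA [pT p0] pI pS pC] := stoneP p.
apply/mem_set; split.
- by move=> U [].
- split; last by move=> [].
  by split=> //; exact: generated_G_algebraT.
- by move=> U V [pU AU] [pV AV]; split; [exact: pI|exact: generated_G_algebraI].
- move=> U V [pU AU] AV UV; split=> //; apply: (pS U) => //.
  exact: generated_G_algebraS AV.
- move=> U AU; have [_ AC _ _] := generated_G_algebraP D.
  have [pU|pU] := pC _ (generated_G_algebraS DD' AU); [left|right]; split=> //.
  exact: AC.
Qed.

Definition stone_restrict (p : stone clD') : stone clD :=
  exist _ (val p `&` generated_G_algebra D) (stone_restrict_subproof p).

Lemma stone_restrict_point x :
  stone_restrict (stone_point clD' x) = stone_point clD x.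
Proof.
apply: val_inj; apply/seteqP; split=> U [].
  by move=> [_ Ux] AU.
by move=> AU Ux; split=> //; split=> //; exact: generated_G_algebraS AU.
Qed.

Lemma stone_restrict_continuous : continuous stone_restrict.
Proof.
move=> p W /stone_nbhsP[U [pU AU] UW]; apply/stone_nbhsP.
by exists U => // q qU; apply: UW.
Qed.

Lemma stone_restrict_act g p :
  stone_restrict (act g p) = act g (stone_restrict p).
Proof.
have [x <-] := stone_point_surj p.
by rewrite -stone_point_act !stone_restrict_point stone_point_act.
Qed.

End Restriction.

Definition stone_index : Type :=
  {D : set (set (set X)) | D `<=` @clopen_orbits G X /\ finite_set D}.

Definition stone_index_le (i j : stone_index) : Prop := sval i `<=` sval j.

Lemma stone_index_directed : directed stone_index_le.
Proof.
split.
- by constructor; exists set0; split; [exact: sub0set|exact: finite_set0].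
- by move=> i; exact: subset_refl.
- by move=> i j k; exact: subset_trans.
move=> [D [clD fD]] [D' [clD' fD']].
have DD' : D `|` D' `<=` @clopen_orbits G X /\ finite_set (D `|` D').
  by split; [rewrite subUset|rewrite finite_setU].
by exists (exist _ (D `|` D') DD'); split=> O; [left|right].
Qed.

Definition stone_stage (i : stone_index) : flowType G := stone (svalP i).1.

Lemma stone_restrict_id (i : stone_index) (ii : stone_index_le i i)
    (p : stone_stage i) : stone_restrict _ ii p = p.
Proof.
have [x <-] := stone_point_surj p; exact: stone_restrict_point.
Qed.

Lemma stone_restrict_comp (i j k : stone_index) (ij : stone_index_le i j)
    (jk : stone_index_le j k) (ik : stone_index_le i k) (p : stone_stage k) :
  stone_restrict (svalP i).1 ij (stone_restrict (svalP j).1 jk p) =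
  stone_restrict _ ik p.
Proof. by have [x <-] := stone_point_surj p; rewrite !stone_restrict_point. Qed.

Definition stone_system : inverse_system G :=
  @InverseSystem G stone_index stone_index_le stone_index_directed stone_stage
    (fun i j ij => @stone_restrict _ _ (svalP i).1 (svalP j).1 ij)
    (fun i j ij => @stone_restrict_continuous _ _ _ _ ij)
    (fun i j ij => @stone_restrict_act _ _ _ _ ij)
    stone_restrict_id stone_restrict_comp.

Lemma stone_thread_subproof (x : X) :
  (fun i : sys_index stone_system => stone_point (svalP i).1 x)
    \in @threads G stone_system.
Proof. by apply/mem_set => i j ij; exact: stone_restrict_point. Qed.

Definition stone_thread (x : X) : inverse_limit stone_system :=
  exist _ (fun i : sys_index stone_system => stone_point (svalP i).1 x)
    (stone_thread_subproof x).

Lemma stone_thread_continuous : continuous stone_thread.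
Proof.
apply: (@continuous_comp_initial _ X (prod_topology (@stage G stone_system)) set_val).
move=> x; apply: (prod_cvgP _ (fmap_filter _ (nbhs_filter x))).2 => i.
exact: stone_point_continuous.
Qed.

(** The fibres of X over the coordinates of a thread form a directed family of
    nonempty closed sets. *)
Lemma stone_thread_surj (t : inverse_limit stone_system) :
  exists x, stone_thread x = t.
Proof.
pose E (i : stone_index) := [set x : X | stone_point (svalP i).1 x = val t i].
have tP : @threads G stone_system (val t) by have := valP t; rewrite inE.
have ES (i j : stone_index) : stone_index_le i j -> E j `<=` E i.
  move=> ij x /= xt; rewrite /E /= -(tP i j ij) -xt; exact/esym/stone_restrict_point.
have [[i0] _ _ dir] := stone_index_directed.
have PF : ProperFilter (filter_from setT E).
  apply: filter_from_proper; last by move=> i _; exact: stone_point_surj.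
  apply: filter_from_filter; first by exists i0.
  move=> i j _ _; have [k [ik jk]] := dir i j; exists k => // x Ek.
  by split; [exact: ES Ek|exact: ES Ek].
have [x [_ clx]] := @flow_compact G X _ PF filterT.
exists x; apply: val_inj; apply: functional_extensionality_dep => i.
apply: (@flow_hausdorff G (stone_stage i)) => U V xU tV.
have FE : filter_from setT E (E i) by exists i.
have [y [Ey Uy]] := clx _ _ FE (@stone_point_continuous _ _ _ (svalP i).1 x _ xU).
exists (val t i); split; last exact: nbhs_singleton.
by rewrite -Ey.
Qed.

Hypothesis X_dim0 : zero_dimensional_basis X.

Lemma stone_thread_inj : injective stone_thread.
Proof.
move=> x y xy; apply: contrapT => /eqP nxy.
have [U [clU Ux Uy]] := zero_dimensional_basis_separated X_dim0 nxy.
have DP : [set @set_orbit G X U] `<=` @clopen_orbits G X /\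
    finite_set [set @set_orbit G X U].
  by split; [move=> _ ->; exists U|exact: finite_set1].
pose i : sys_index stone_system := exist _ [set @set_orbit G X U] DP.
have := congr1 (fun t => val (val t i) U) xy.
move=> /= E; have : generated_G_algebra [set @set_orbit G X U] U /\ U x.
  by split=> //; exact: generated_G_algebra_base.
by rewrite E => -[_ /Uy].
Qed.

Lemma flow_iso_stone_limit : flow_iso X (inverse_limit stone_system).
Proof.
have [f' f'K] := choice stone_thread_surj.
exists stone_thread, f'; split=> //.
- by move=> x; apply: stone_thread_inj; rewrite f'K.
- exact: stone_thread_continuous.
- apply: separated_continuous; first exact: flow_compact.
  move=> y z yz; apply: stone_thread_inj; apply: yz.
  + exact: flow_hausdorff.
  + exact: stone_thread_continuous.
  + by rewrite (_ : _ \o _ = id) => [t|]; [exact: cvg_id|apply/funext].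
- move=> g x; apply: val_inj; apply: functional_extensionality_dep => i.
  exact: stone_point_act.
Qed.

End StoneSystem.

Lemma directed_finite_bound (I : Type) (le : I -> I -> Prop) (T : choiceType)
    (D : set T) (P : T -> I -> Prop) :
  directed le -> (forall O i j, le i j -> P O i -> P O j) -> finite_set D ->
  (forall O, D O -> exists i, P O i) -> exists i, forall O, D O -> P O i.
Proof.
move=> [[i0] _ _ dir] mono.
move=> /finite_seqP[s ->]; elim: s => [|O s IH] sP; first by exists i0.
have [i iP] : exists i, P O i by apply: sP; rewrite /= mem_head.
have [|j jP] := IH; first by move=> O' /= O's; apply: sP; rewrite /= inE O's orbT.
have [k [ik jk]] := dir i j; exists k => O'; rewrite /= inE => /orP[/eqP ->|O's].
  exact: mono iP.
by apply: mono jk _; exact: jP.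
Qed.

Section InverseLimitFactor.
Variables (G : topologicalGroupType) (X : flowType G) (S : inverse_system G).
Variable phi : X -> inverse_limit S.
Hypotheses (phi_inj : injective phi) (cphi : continuous phi)
  (phiA : forall g x, phi (act g x) = act g (phi x)).

Definition limit_proj (i : sys_index S) (x : X) : stage i := val (phi x) i.

Lemma limit_proj_continuous i : continuous (limit_proj i).
Proof.
move=> x; apply: (@continuous_comp _ _ _ phi
  (fun t : inverse_limit S => val t i)); first exact: cphi.
apply: (@continuous_comp _ _ _ (val : inverse_limit S -> _)
  (fun t : prod_topology (@stage G S) => t i)).
  exact: val_subflow_continuous.
exact: prod_eval_continuous.
Qed.

Lemma limit_proj_act i g x : limit_proj i (act g x) = act g (limit_proj i x).
Proof. by rewrite /limit_proj phiA. Qed.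

Lemma limit_proj_mono i j x y : sys_le i j -> limit_proj j x = limit_proj j y ->
  limit_proj i x = limit_proj i y.
Proof.
move=> ij xy; have thr z : @threads G S (val (phi z)).
  by have := valP (phi z); rewrite inE.
by rewrite /limit_proj -(thr x i j ij) -(thr y i j ij) -!/(limit_proj _ _) xy.
Qed.

(** The sets E i of pairs with the same projection to stage i decrease to the
    diagonal, which lies in the open set of pairs that U does not separate. By
    compactness some E i lies in this open set. *)
Lemma limit_proj_clopen (U : set X) : clopen U ->
  exists i, forall x y, limit_proj i x = limit_proj i y -> U x -> U y.
Proof.
move=> [oU cU]; have [[i0] _ _ dir] := @sys_directed _ S.
pose E i := [set xy : X * X | limit_proj i xy.1 = limit_proj i xy.2].
have FF : Filter (filter_from setT E).
  apply: filter_from_filter; first by exists i0.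
  move=> i j _ _; have [k [ik jk]] := dir i j; exists k => // xy Ek.
  by split; [exact: limit_proj_mono ik Ek|exact: limit_proj_mono jk Ek].
have oUC : open (~` U) by exact: closed_openC.
have oX (V : set X) : open V -> open (V `*` V).
  move=> oV; rewrite openE => -[x y] [/= Vx Vy].
  by exists (V, V) => //; split; apply: open_nbhs_nbhs.
have oW : open (U `*` U `|` (~` U) `*` (~` U)) by apply: openU; exact: oX.
have cXX : compact [set: X * X].
  by rewrite -setXTT; apply: compact_setX; exact: flow_compact.
have [|i _ Ei] := compact_cluster_open FF cXX oW.
  move=> [x y] clxy; suff -> : x = y.
    by have [Uy|nUy] := pselect (U y); [left|right].
  apply: phi_inj; apply: val_inj; apply: functional_extensionality_dep => i.
  apply: (@flow_hausdorff G (stage i)) => A B xA yB.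
  have FE : filter_from setT E (E i) by exists i.
  have nAB : nbhs (x, y) ((limit_proj i @^-1` A) `*` (limit_proj i @^-1` B)).
    by exists (limit_proj i @^-1` A, limit_proj i @^-1` B) => //; split;
      exact: limit_proj_continuous.
  have [[x' y'] [/= E' [/= Ax By]]] := clxy _ _ FE nAB.
  by exists (limit_proj i x'); split=> //; rewrite E'.
by exists i => x y xy Ux; have [[]|[]] := Ei (x, y) xy.
Qed.

(** One stage works for representatives of the finitely many orbits in D; by
    equivariance it works for all translates, and then for the algebra that they
    generate. *)
Lemma stone_factor_stage (D : set (set (set X))) (clD : D `<=` @clopen_orbits G X) :
  finite_set D -> exists i, forall x y, limit_proj i x = limit_proj i y ->
    stone_point clD x = stone_point clD y.
Proof.
move=> finD.
have [i iP] : exists i, forall O, D O -> forall U, O U -> forall x y,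
    limit_proj i x = limit_proj i y -> U x -> U y.
  apply: (directed_finite_bound (@sys_directed _ S)) finD _ => [O i j ij Oi U OU x y xy|].
    exact: Oi OU _ _ (limit_proj_mono ij xy).
  move=> O /clD[V clV <-]; have [i iV] := limit_proj_clopen clV.
  exists i => _ [g _ <-] x y xy; rewrite mem_translate /=.
  by apply: iV; rewrite !limit_proj_act xy.
exists i.
have AE U : generated_G_algebra D U -> forall x y,
    limit_proj i x = limit_proj i y -> U x -> U y.
  apply: (smallest_sub (X := [set U | forall x y,
    limit_proj i x = limit_proj i y -> U x -> U y])).
    split=> //.
    - by move=> V EV x y xy nVx Vy; apply: nVx; exact: EV (esym xy) Vy.
    - by move=> V V' EV EV' x y xy [Vx|Vx]; [left; exact: EV Vx|right; exact: EV' Vx].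
    - move=> g V EV x y xy; rewrite mem_translate /=; apply: EV.
      by rewrite !limit_proj_act xy.
  by move=> V [O DO OV]; exact: iP OV.
move=> x y xy; apply: val_inj; apply/seteqP.
by split=> U [AU Ux]; split=> //; apply: AE Ux.
Qed.

Lemma limit_finite_ellis_stone :
  (forall i : sys_index S, finite_ellis_group (stage i)) ->
  forall (D : set (set (set X))) (clD : D `<=` @clopen_orbits G X),
    finite_set D -> finite_ellis_group (stone clD).
Proof.
move=> finS D clD finD; have [i iP] := stone_factor_stage clD finD.
have [theta [thetaM theta_surj _]] := ellis_hom_exists
  (@limit_proj_continuous i) (@stone_point_continuous _ _ _ clD)
  (limit_proj_act i) (stone_point_act clD) (@stone_point_surj _ _ _ clD) iP.
exact: finite_ellis_group_image (finS i).
Qed.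

End InverseLimitFactor.

(** * Elements of finite image *)

Section FiniteImage.
Variables (G : topologicalGroupType) (Y : flowType G).

Lemma ellis_fun_exp (a : ellis Y) n y :
  ellis_fun (a ^+ n) y = iter n (ellis_fun a) y.
Proof. by elim: n => [|n IH] //; rewrite expgS iterS -IH. Qed.

(** If eta takes its values in a list s of the smallest possible length and a is
    not injective on s, then a eta takes its values in a shorter list. *)
Lemma minimal_finite_image :
  (exists eta : ellis Y, finite_set (range (ellis_fun eta))) ->
  exists (eta : ellis Y) (s : seq Y), (forall y, ellis_fun eta y \in s) /\
    forall a : ellis Y, {in s &, injective (ellis_fun a)}.
Proof.
move=> [eta0 /finite_seqP[s0 s0E]].
pose P n := `[< exists (eta : ellis Y) (s : seq Y),
  size s = n /\ forall y, ellis_fun eta y \in s >].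
have exP : exists n, P n.
  exists (size s0); apply/asboolP; exists eta0, s0; split=> // y.
  have : range (ellis_fun eta0) (ellis_fun eta0 y) by exists y.
  by rewrite s0E.
have [n /asboolP[eta [s [sn eta_s]]] n_min] := ex_minnP exP.
exists eta, s; split=> // a.
have uniq_as : uniq (map (ellis_fun a) s).
  rewrite -[uniq _]negbK -ltn_size_undup size_map -leqNgt sn.
  apply: n_min; apply/asboolP; exists (a * eta), (undup (map (ellis_fun a) s)).
  by split=> // y; rewrite mem_undup; apply: map_f; exact: eta_s.
move=> x y xs ys axy.
have ix := nth_index x xs; have iy := nth_index x ys.
have is_ z : z \in s -> (index z s < size s)%N by rewrite index_mem.
rewrite -ix -iy; congr nth; apply/eqP.
rewrite -(nth_uniq (ellis_fun a x) _ _ uniq_as) ?size_map ?is_ //.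
by rewrite !(nth_map x) ?is_ // ix iy axy.
Qed.

(** As all elements are injective on s, each eta a restricts to a permutation of
    the finite set s. *)
Lemma finite_image_ellis_group :
  (exists eta : ellis Y, finite_set (range (ellis_fun eta))) ->
  finite_ellis_group Y.
Proof.
move=> /minimal_finite_image[eta [s [eta_s inj_s]]].
have periodic (a : ellis Y) :
    exists n, {in s, forall x, ellis_fun ((eta * a) ^+ n.+1) x = x}.
  pose c (i : seq_sub s) : seq_sub s :=
    SeqSub (eta_s (ellis_fun a (ssval i))).
  have c_inj : injective c.
    move=> i j /(congr1 (@ssval _ _)) cij; apply: val_inj.
    by apply: (inj_s (eta * a)) => //; exact: valP.
  have ssval_iter m i : ssval (iter m c i) = iter m (ellis_fun (eta * a)) (ssval i).
    by elim: m => //= m ->.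
  exists #[perm c_inj].-1 => x xs; rewrite prednK ?order_gt0 // ellis_fun_exp.
  rewrite -(ssval_iter _ (SeqSub xs)) -(eq_iter (permE c_inj)) -permX.
  by rewrite expg_order perm1.
pose M := [set a * eta | a in [set: ellis Y]].
have minM : minimal_left_ideal M.
  split=> [|N [[m Nm] idN] NM].
    split; first by exists (1 * eta); exists 1.
    by move=> b _ [a _ <-]; exists (b * a) => //; rewrite mulgA.
  have [a _ am] := NM _ Nm; have [n nP] := periodic a.
  apply/seteqP; split=> // _ [b _ <-].
  (* eta is recovered from m = a eta, a power of eta a being the identity on
     the image of eta *)
  have -> : eta = (eta * a) ^+ n * eta * m.
    apply: val_inj; apply/funext => y; rewrite -am.
    transitivity (ellis_fun ((eta * a) ^+ n.+1) (ellis_fun eta y)).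
      by rewrite nP.
    by rewrite expgSr.
  by rewrite mulgA; exact: idN.
(* a power of eta itself, the case a = 1, is the idempotent *)
have [n nP] := periodic 1; rewrite mulg1 in nP.
set u := eta ^+ n.+1 in nP.
have u_s y : ellis_fun u y \in s by rewrite /u expgS; exact: eta_s.
have Mu : M u by exists (eta ^+ n) => //; rewrite /u expgSr.
have uu : u * u = u by apply: val_inj; apply/funext => y; exact: nP.
exists M, u, minM, Mu, uu.
have p_s (p : ellis_group minM Mu uu) y : ellis_fun (val p) y \in s.
  by rewrite -ellis_group_mull; exact: u_s.
(* p = p u depends on its values on s only *)
pose F (p : ellis_group minM Mu uu) : {ffun seq_sub s -> seq_sub s} :=
  [ffun i => SeqSub (p_s p (ssval i))].
suff injF : {in F @^-1` setT &, injective F}.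
  exact: finite_preimage injF (@finite_finset _ _).
move=> p q _ _ pq; apply: val_inj.
rewrite -[val p]ellis_group_mulr -[val q]ellis_group_mulr.
apply: val_inj; apply/funext => y /=.
have := congr1 (fun g : {ffun _ -> _} => ssval (g (SeqSub (u_s y)))) pq.
by rewrite !ffunE.
Qed.

End FiniteImage.

Theorem proposition3p25 (G : topologicalGroupType) (X : flowType G) (x0 : X)
    (x0_ambit : ambit x0) (X_dim0 : zero_dimensional_basis X)
    (M : set (ellis X)) (minM : minimal_left_ideal M)
    (u : ellis X) (Mu : M u) (uu : u * u = u) :
  let A''' := profinite_bohr_below x0 in
  let A'' := profinite_bohr_below (1 : ellis X) in
  let A' := profinite_quotient (ellis_group_H minM Mu uu) in
  let A := profinite_group (ellis_group minM Mu uu) in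
  let B := exists S : inverse_system G,
    flow_iso X (inverse_limit S) /\
    forall i : sys_index S, finite_ellis_group (stage i) in
  let C := forall (Delta : set (set (set X)))
      (subDelta : Delta `<=` clopen_orbits X),
    finite_set Delta -> finite_ellis_group (stone subDelta) in
  let D := forall (Delta : set (set (set X)))
      (subDelta : Delta `<=` clopen_orbits X),
    finite_set Delta ->
    exists eta : ellis (stone subDelta), finite_set (range (ellis_fun eta)) in
  [/\ D -> C, C <-> B, B -> A, A -> A' & (A' -> A'') /\ (A'' -> A''')].
Proof.
move=> A''' A'' A' A B C D.
have B_C : B -> C.
  move=> [S [[phi [phi' [phiK _ cphi _ phiA]]] finS]] Delta subDelta.
  exact: (limit_finite_ellis_stone (can_inj phiK) cphi phiA finS).
split.
- by move=> finD Delta subDelta /(finD _ subDelta); exact: finite_image_ellis_group.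
- split=> // finC; exists (stone_system X); split.
    exact: flow_iso_stone_limit.
  by move=> i; apply: finC; exact: (svalP i).2.
- by move=> /B_C; exact: stone_finite_ellis_profinite.
- exact: profinite_ellis_group_quotient.
- split; first exact: profinite_quotient_bohr.
  exact: profinite_bohr_descends.
Qed.
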